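(* For each $j=9,\dots,20$, the graded $\mathfrak{R}$-module $M(\rho_j)$ is free of rank $2$: there exist homogeneous elements $\mathbf{u}_j^{(1)},\mathbf{u}_j^{(2)}\in M(\rho_j)$ with $$M(\rho_j)=\mathfrak{R}\,\mathbf{u}_j^{(1)}\oplus\mathfrak{R}\,\mathbf{u}_j^{(2)},$$ and these can be chosen so that $$\det\bigl([\mathbf{u}_j^{(1)}\ \mathbf{u}_j^{(2)}]\bigr)=c_j\,\Delta\,\Gamma^{k_j},$$ where $[\mathbf{u}_j^{(1)}\ \mathbf{u}_j^{(2)}]$ is the $2\times2$ matrix with these columns, and where the constants $c_j\in\mathbb{C}^\times$, $k_j\in\mathbb{Z}$, the degrees, and the beginning of the Hilbert series $\sum_{d\ge0}\dim_{\mathbb{C}}(M(\rho_j)_d)t^d$ (all terms up to the last degree shown) are as follows: $$\begin{array}{c|cccc|l} j&c_j&k_j&\deg\mathbf{u}_j^{(1)}&\deg\mathbf{u}_j^{(2)}&\text{Hilbert series}\\\hline 9&-1&1&1&17&t+t^{9}+2t^{17}+3t^{25}+3t^{33}+\cdots\\ 10&9&3&7&23&t^7+t^{15}+2t^{23}+3t^{31}+3t^{39}+\cdots\\ 11&-1&5&13&29&t^{13}+t^{21}+2t^{29}+3t^{37}+3t^{45}+\cdots\\ 12&176&3&11&19&t^{11}+2t^{19}+2t^{27}+3t^{35}+4t^{43}+\cdots\\ 13&4&1&5&13&t^5+2t^{13}+2t^{21}+3t^{29}+4t^{37}+\cdots\\ 14&6&3&11&19&t^{11}+2t^{19}+2t^{27}+3t^{35}+4t^{43}+\cdots\\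 15&-1&5&17&25&t^{17}+2t^{25}+2t^{33}+3t^{41}+4t^{49}+\cdots\\ 16&1773&3&7&23&t^7+t^{15}+2t^{23}+3t^{31}+3t^{39}+\cdots\\ 17&-411&2&8&16&t^8+2t^{16}+2t^{24}+3t^{32}+4t^{40}+\cdots\\ 18&-10&4&10&26&t^{10}+t^{18}+2t^{26}+3t^{34}+3t^{42}+\cdots\\ 19&1&2&4&20&t^4+t^{12}+2t^{20}+3t^{28}+3t^{36}+\cdots\\ 20&-1&4&14&22&t^{14}+2t^{22}+2t^{30}+3t^{38}+4t^{46}+\cdots \end{array}$$ In particular, $\deg\mathbf{u}_j^{(1)}+\deg\mathbf{u}_j^{(2)}=\deg\Delta+k_j\deg\Gamma=12+6k_j$.
   Context: $\mathfrak{G}\subset\mathrm{GL}(2,\mathbb{C})$ is the finite group (of order $192$) generated by $T=\frac{1}{\sqrt2}\begin{pmatrix}1&1\\1&-1\end{pmatrix}$ and $D=\begin{pmatrix}1&0\\0&i\end{pmatrix}$. It acts on $\mathbb{C}[x,y]$ by $(g\cdot f)(\mathbf{x})=f(g\mathbf{x})$, $\mathbf{x}=(x,y)^{\mathsf T}$, and $\mathfrak{R}=\mathbb{C}[x,y]^{\mathfrak{G}}$ is the invariant ring; $\mathfrak{R}=\mathbb{C}[\theta,\varphi]$ with $\theta=x^8+14x^4y^4+y^8$ and $\varphi=x^{24}+759x^{16}y^8+2576x^{12}y^{12}+759x^8y^{16}+y^{24}$ algebraically independent. Further, $$\Gamma=-x^5y+xy^5,\qquad \Delta=x^{12}-33x^8y^4-33x^4y^8+y^{12}.$$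 For a representation $\rho:\mathfrak{G}\to\mathrm{GL}(m,\mathbb{C})$, the module of vector-valued invariants is $$M(\rho)=\{F\in\mathbb{C}[x,y]^m : F(\sigma\mathbf{x})=\rho(\sigma)F(\mathbf{x})\ \text{for all }\sigma\in\mathfrak{G}\},$$ a graded $\mathfrak{R}$-module; $M(\rho)_d$ is the subspace of elements whose components are homogeneous of degree $d$, and the degree of a nonzero homogeneous element is the common degree of its components. The two-dimensional irreducible representations of $\mathfrak{G}$ are given by the images of the generators as follows. For $j=9,\dots,16$: $\rho_j(T)=\varepsilon T$, $\rho_j(D)=\eta D$ with $(\varepsilon,\eta)=(1,1),(1,i),(1,-1),(1,-i),(-1,1),(-1,i),(-1,-1),(-1,-i)$ respectively. For $j=17,\dots,20$, put $S=\frac12\begin{pmatrix}1&3\\1&-1\end{pmatrix}$; then $\rho_j(T)=S$ for all four, and $$\rho_{17}(D)=\mathrm{diag}(-1,1),\quad \rho_{18}(D)=\mathrm{diag}(i,-i),\quad \rho_{19}(D)=\mathrm{diag}(1,-1),\quad \rho_{20}(D)=\mathrm{diag}(-i,i).$$ *)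

(* Defs.v *)
From HB Require Import structures.
From mathcomp Require Import all_boot all_order all_algebra.
From mathcomp Require Import mpoly.

Set Implicit Arguments.
Unset Strict Implicit.
Unset Printing Implicit Defensive.

Import GRing.Theory Num.Theory.
Local Open Scope ring_scope.

Section Defs.

(* Plays the role of the complex numbers; 'i and sqrtC 2 are then the usual
   i and square root of 2 of C = R[i], for R : realType. *)
Variable C : numClosedFieldType.

Definition mx22 (a b c d : C) : 'M[C]_2 :=
  \matrix_(i, j) (if i == 0 then (if j == 0 then a else b)
                  else (if j == 0 then c else d)).

Definition matT : 'M[C]_2 := (sqrtC 2)^-1 *: mx22 1 1 1 (-1).
Definition matD : 'M[C]_2 := mx22 1 0 0 'i.
Definition matS : 'M[C]_2 := 2^-1 *: mx22 1 3 1 (-1).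

Inductive in_G : 'M[C]_2 -> Prop :=
| in_G_T : in_G matT
| in_G_D : in_G matD
| in_G_1 : in_G 1%:M
| in_G_mul g h : in_G g -> in_G h -> in_G (g *m h)
| in_G_inv g : in_G g -> in_G (invmx g).

Local Notation pol := {mpoly C[2]}.

Definition px : pol := 'X_0.
Definition py : pol := 'X_1.

(* f(g x): the i-th variable is replaced by the i-th entry of g (x, y)^T. *)
Definition act (g : 'M[C]_2) (f : pol) : pol :=
  f \mPo [tuple g i 0 *: px + g i 1 *: py | i < 2].

Definition invariant (f : pol) : Prop := forall g, in_G g -> act g f = f.

Definition Gamma : pol := - px ^+ 5 * py + px * py ^+ 5.

Definition Delta : pol :=
  px ^+ 12 - (px ^+ 8 * py ^+ 4) *+ 33 - (px ^+ 4 * py ^+ 8) *+ 33 + py ^+ 12.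

(* A homomorphism G -> GL(m, C), as a total function on 2 x 2 matrices whose
   values outside G are irrelevant. *)
Definition representation m (rho : 'M[C]_2 -> 'M[C]_m) : Prop :=
  (forall g, in_G g -> rho g \in unitmx) /\
  (forall g h, in_G g -> in_G h -> rho (g *m h) = rho g *m rho h).

Definition in_M m (rho : 'M[C]_2 -> 'M[C]_m) (F : 'cV[pol]_m) : Prop :=
  forall g, in_G g -> map_mx (act g) F = map_mx (@mpolyC 2 C) (rho g) *m F.

Definition in_Md m (rho : 'M[C]_2 -> 'M[C]_m) (d : nat) (F : 'cV[pol]_m) :=
  in_M rho F /\ forall i, F i 0 \is d.-homog.

(* u is a basis over the ring of invariants of the module of
   vector-valued invariants of rho. *)
Definition free_basis m (rho : 'M[C]_2 -> 'M[C]_m) r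
    (u : 'I_r -> 'cV[pol]_m) : Prop :=
  [/\ forall i, in_M rho (u i),
      forall F, in_M rho F -> exists a : 'I_r -> pol,
        (forall i, invariant (a i)) /\ F = \sum_i a i *: u i
    & forall a : 'I_r -> pol, (forall i, invariant (a i)) ->
        \sum_i a i *: u i = 0 -> forall i, a i = 0].

(* V, a C-linear subspace of C[x, y]^m, has dimension n. *)
Definition has_dim m (V : 'cV[pol]_m -> Prop) (n : nat) : Prop :=
  exists b : 'I_n -> 'cV[pol]_m,
    [/\ forall i, V (b i),
        forall F, V F -> exists a : 'I_n -> C, F = \sum_i (a i)%:MP *: b i
      & forall a : 'I_n -> C,
          \sum_i (a i)%:MP *: b i = 0 -> forall i, a i = 0].

(* The columns: images of T and D; constant and exponent of Gamma in the
   determinant; degrees of the two generators; truncated Hilbert series. *)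
Record entry := Entry {
  tab_T : 'M[C]_2;
  tab_D : 'M[C]_2;
  tab_c : int;
  tab_k : nat;
  tab_d1 : nat;
  tab_d2 : nat;
  tab_H : {poly nat} }.

Definition table (j : nat) : entry :=
  match j with
  | 9%N => Entry matT matD (-1) 1 1 17
             ('X + 'X^9 + 'X^17 *+ 2 + 'X^25 *+ 3 + 'X^33 *+ 3)
  | 10%N => Entry matT ('i *: matD) 9 3 7 23
             ('X^7 + 'X^15 + 'X^23 *+ 2 + 'X^31 *+ 3 + 'X^39 *+ 3)
  | 11%N => Entry matT (- matD) (-1) 5 13 29
             ('X^13 + 'X^21 + 'X^29 *+ 2 + 'X^37 *+ 3 + 'X^45 *+ 3)
  | 12%N => Entry matT (- 'i *: matD) 176 3 11 19
             ('X^11 + 'X^19 *+ 2 + 'X^27 *+ 2 + 'X^35 *+ 3 + 'X^43 *+ 4)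
  | 13%N => Entry (- matT) matD 4 1 5 13
             ('X^5 + 'X^13 *+ 2 + 'X^21 *+ 2 + 'X^29 *+ 3 + 'X^37 *+ 4)
  | 14%N => Entry (- matT) ('i *: matD) 6 3 11 19
             ('X^11 + 'X^19 *+ 2 + 'X^27 *+ 2 + 'X^35 *+ 3 + 'X^43 *+ 4)
  | 15%N => Entry (- matT) (- matD) (-1) 5 17 25
             ('X^17 + 'X^25 *+ 2 + 'X^33 *+ 2 + 'X^41 *+ 3 + 'X^49 *+ 4)
  | 16%N => Entry (- matT) (- 'i *: matD) 1773 3 7 23
             ('X^7 + 'X^15 + 'X^23 *+ 2 + 'X^31 *+ 3 + 'X^39 *+ 3)
  | 17%N => Entry matS (mx22 (-1) 0 0 1) (-411) 2 8 16
             ('X^8 + 'X^16 *+ 2 + 'X^24 *+ 2 + 'X^32 *+ 3 + 'X^40 *+ 4)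
  | 18%N => Entry matS (mx22 'i 0 0 (- 'i)) (-10) 4 10 26
             ('X^10 + 'X^18 + 'X^26 *+ 2 + 'X^34 *+ 3 + 'X^42 *+ 3)
  | 19%N => Entry matS (mx22 1 0 0 (-1)) 1 2 4 20
             ('X^4 + 'X^12 + 'X^20 *+ 2 + 'X^28 *+ 3 + 'X^36 *+ 3)
  | 20%N => Entry matS (mx22 (- 'i) 0 0 'i) (-1) 4 14 22
             ('X^14 + 'X^22 *+ 2 + 'X^30 *+ 2 + 'X^38 *+ 3 + 'X^46 *+ 4)
  | _ => Entry 1%:M 1%:M 0 0 0 0 0 (* unused: j ranges over 9, ..., 20 *)
  end.

(* rho is the representation rho_j: it is determined on G by the images of
   the generators. *)
Definition is_rho (j : nat) (rho : 'M[C]_2 -> 'M[C]_2) : Prop :=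
  [/\ representation rho,
      rho matT = tab_T (table j)
    & rho matD = tab_D (table j)].

End Defs.

(* Main.v *)
Require Import Defs.
From HB Require Import structures.
From mathcomp Require Import all_boot all_order all_algebra.
From mathcomp Require Import mpoly complex reals.
From mathcomp Require Import ring.

Set Implicit Arguments.
Unset Strict Implicit.
Unset Printing Implicit Defensive.

Import GRing.Theory Num.Theory.
Local Open Scope ring_scope.

(** Why the theorem holds.

    Fix a row of the table, with [rho T = A], [det A = -1] and
    [rho D = diag (i^a, i^b)], where [0 <= a, b < 4].  If [F] and [H] are
    vector-valued invariants of [rho], then [f = det [F H]] is a relative
    invariant: [f (T x) = - f] and [f (D x) = i^(a+b) f].  The point is that such an
    [f] is always [q * Delta * Gamma^(a+b)] with [q] invariant ([det_equivariant]):
    - the equation for [D] leaves in the two components of [F] only the powers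
      [y^(a+4n)], respectively [y^(b+4n)] ([D_eigen_y_pow]), so that [y^(a+b)]
      divides [f];
    - a relative invariant vanishing on the line [y = 0] vanishes on the whole
      orbit of this line, which consists of the six lines of [Gamma], so that
      [Gamma] divides it ([Gamma_dvd]); by induction [Gamma^(a+b)] divides [f];
    - the quotient still changes sign under the reflection [T], hence vanishes on
      the mirror of [T] and on its orbit, the twelve lines of [Delta]
      ([Delta_dvd]).
    Consequently, if [det [u1 u2]] is a nonzero constant times
    [Delta * Gamma^(a+b)], Cramer's rule expresses every [F] in [u1] and [u2] with
    invariant coefficients ([in_M_span]), and uniquely.

    All the generators come from six vectors: [(x, y)], the rotated gradients of
    [Gamma], [theta] and [Delta], and two vectors of degrees 4 and 8 for the
    two-dimensional representation with [rho T = S].  Multiplying by [Gamma] or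
    [Delta] twists [rho] by a character and reaches every row; rescaling [u2]
    gives the constant [c_j].

    Existence of [rho] follows from the same pair [u1, u2]: since its determinant
    is not zero, the equation [act g U = rho g * U] for the matrix [U = [u1 u2]]
    has at most one solution [rho g], and one exists for the generators
    ([exists_rep]).

    For the Hilbert series, an invariant of degree [e] is zero unless [8] divides
    [e], because the group contains a primitive eighth root of unity as a scalar
    matrix.  If [8] divides [e], subtracting a multiple of [theta^(e/8)] makes the
    invariant vanish on [y = 0], so [Gamma^4] divides it.  Hence the invariants of degree [e]
    have the basis [theta^(e/8-3i) Gamma^(4i)], and [M(rho)_d] is the sum of the
    invariants of degrees [d - d1] and [d - d2] ([has_dim_M]). *)

Section Invariants.

Variable C : numClosedFieldType.
Local Notation pol := {mpoly C[2]}.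
Local Notation x := (px C).
Local Notation y := (py C).
Local Notation T := (matT C).
Local Notation D := (matD C).
Local Notation invariant := Defs.invariant.
Local Notation s := (sqrtC 2 : C).
Local Notation r := ((sqrtC 2)^-1%:MP : pol).
Local Notation Gamma := (Gamma C).
Local Notation Delta := (Delta C).
Local Notation cst := (map_mx (@mpolyC 2 C)).

(** * Linear substitutions *)

Lemma pol_ind (P : pol -> Prop) :
  (forall c, P c%:MP) -> P x -> P y ->
  (forall f g, P f -> P g -> P (f + g)) ->
  (forall f g, P f -> P g -> P (f * g)) -> forall f, P f.
Proof.
move=> PC Px Py PD PM; have PX f n : P f -> P (f ^+ n).
  by move=> Pf; elim: n => [|n IHn]; [rewrite expr0 -mpolyC1|rewrite exprS; apply: (PM)].
elim/mpolyind => [|c m p _ _ IH]; first by rewrite -mpolyC0.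
apply: PD => //; rewrite -mul_mpolyC; apply: (PM) => //.
by rewrite mpolyXE_id big_ord_recl big_ord1; apply: (PM); apply: (PX).
Qed.

Definition subst (p q : pol) : pol -> pol := comp_mpoly [tuple p; q].

HB.instance Definition _ p q := GRing.RMorphism.copy (subst p q) (comp_mpoly [tuple p; q]).

Lemma substC p q c : subst p q c%:MP = c%:MP. Proof. exact: comp_mpolyC. Qed.
Lemma substx p q : subst p q x = p. Proof. exact: comp_mpolyXU. Qed.
Lemma substy p q : subst p q y = q. Proof. exact: comp_mpolyXU. Qed.

(* Unification must not compute with concrete polynomials. *)
Opaque px py mpolyC.

Lemma subst_comp p q r s f :
  subst r s (subst p q f) = subst (subst r s p) (subst r s q) f.
Proof.
elim/pol_ind: f => [c|||f g Hf Hg|f g Hf Hg].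
- by rewrite !substC.
- by rewrite !substx.
- by rewrite !substy.
- by rewrite !rmorphD /= Hf Hg.
by rewrite !rmorphM /= Hf Hg.
Qed.

Lemma subst_id f : subst x y f = f.
Proof.
elim/pol_ind: f => [c|||f g Hf Hg|f g Hf Hg].
- by rewrite !substC.
- by rewrite !substx.
- by rewrite !substy.
- by rewrite rmorphD /= Hf Hg.
by rewrite rmorphM /= Hf Hg.
Qed.

Lemma actE g f : act g f = subst ((g 0 0)%:MP * x + (g 0 1)%:MP * y)
                                 ((g 1 0)%:MP * x + (g 1 1)%:MP * y) f.
Proof.
rewrite /act /subst; congr comp_mpoly; apply: eq_from_tnth => i.
rewrite tnth_mktuple !mul_mpolyC; case: i => [[|[|//]] Hi];
by rewrite (tnth_nth 0) /=; congr (_ *: _ + _ *: _); congr (g _ _); apply/val_inj.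
Qed.

HB.instance Definition _ (g : 'M[C]_2) := GRing.RMorphism.copy (act g)
  (comp_mpoly [tuple g i 0 *: x + g i 1 *: y | i < 2]).

Lemma actC g c : act g c%:MP = c%:MP :> pol. Proof. exact: comp_mpolyC. Qed.
Lemma actx g : act g x = (g 0 0)%:MP * x + (g 0 1)%:MP * y.
Proof. by rewrite actE substx. Qed.
Lemma acty g : act g y = (g 1 0)%:MP * x + (g 1 1)%:MP * y.
Proof. by rewrite actE substy. Qed.

Lemma act1 f : @act C 1%:M f = f.
Proof. by rewrite actE !mxE /= mpolyC1 mpolyC0 !mul1r !mul0r addr0 add0r subst_id. Qed.

Lemma subst_lin p q a b :
  subst p q (a%:MP * x + b%:MP * y) = a%:MP * p + b%:MP * q.
Proof. by rewrite rmorphD !rmorphM /= !substC substx substy. Qed.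

Lemma mulmx2E (R : pzSemiRingType) m n (g : 'M[R]_(m, 2)) (h : 'M[R]_(2, n)) i j :
  (g *m h) i j = g i 0 * h 0 j + g i 1 * h 1 j.
Proof.
rewrite mxE big_ord_recl big_ord1 /=; congr (_ + g i _ * h _ j); exact/val_inj.
Qed.

(** The order is reversed: [act] composes a polynomial with the matrix. *)
Lemma actM (g h : 'M[C]_2) f : act (g *m h) f = act h (act g f).
Proof.
rewrite (actE g) (actE h) subst_comp actE !subst_lin !mulmx2E.
rewrite !mpolyCD !mpolyCM.
apply: (f_equal2 (fun p q => subst p q f)); ring.
Qed.

(** * Divisibility by linear forms *)

Definition divides (p f : pol) : Prop := exists q, f = q * p.

(** The equation of the line spanned by [(a, b)]. *)
Definition line a b : pol := b%:MP * x - a%:MP * y.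

(** The restriction of a polynomial to the line spanned by [(a, b)], the variable [x]
    serving as the parameter of the line. *)
Definition restr a b : pol -> pol := subst (a%:MP * x) (b%:MP * x).

HB.instance Definition _ a b := GRing.RMorphism.copy (restr a b) (subst (a%:MP * x) (b%:MP * x)).

Lemma restrC a b c : restr a b c%:MP = c%:MP. Proof. exact: substC. Qed.
Lemma restrx a b : restr a b x = a%:MP * x. Proof. exact: substx. Qed.
Lemma restry a b : restr a b y = b%:MP * x. Proof. exact: substy. Qed.

Lemma x_neq0 : x != 0.
Proof.
by apply/eqP => /(congr1 (mcoeff U_(0))) /eqP; rewrite mcoeffXU mcoeff0 oner_eq0.
Qed.

Lemma y_neq0 : y != 0.
Proof.
by apply/eqP => /(congr1 (mcoeff U_(1))) /eqP; rewrite mcoeffXU mcoeff0 oner_eq0.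
Qed.

Lemma restr_line a b c d : restr a b (line c d) = (a * d - b * c)%:MP * x.
Proof.
rewrite /line rmorphB !rmorphM /= !restrC restrx restry mpolyCB !mpolyCM; ring.
Qed.

(** The line is moved by [g]: this is what carries zeros along the orbit of a line. *)
Lemma restr_act (g : 'M[C]_2) a b f :
  restr a b (act g f) = restr (g 0 0 * a + g 0 1 * b) (g 1 0 * a + g 1 1 * b) f.
Proof.
rewrite actE /restr subst_comp !subst_lin !mpolyCD !mpolyCM.
by apply: (f_equal2 (fun p q => subst p q f)); ring.
Qed.

(** Vanishing on a line does not depend on the vector spanning it. *)
Lemma restr_scale c a b f : restr a b f = 0 -> restr (c * a) (c * b) f = 0.
Proof.
move=> f0; have: subst (c%:MP * x) y (restr a b f) = 0 by rewrite f0 rmorph0.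
rewrite /restr subst_comp !rmorphM /= !substC substx => <-.
by apply: (f_equal2 (fun p q => subst p q f)); ring.
Qed.

Lemma subst_congr l p q p' q' f :
  divides l (p - p') -> divides l (q - q') ->
  divides l (subst p q f - subst p' q' f).
Proof.
move=> hp hq; elim/pol_ind: f => [c|||f g [u Hu] [v Hv]|f g [u Hu] [v Hv]].
- by rewrite !substC subrr; exists 0; rewrite mul0r.
- by rewrite !substx.
- by rewrite !substy.
- by exists (u + v); rewrite !rmorphD /= opprD addrACA Hu Hv mulrDl.
exists (u * subst p q g + subst p' q' f * v); rewrite !(rmorphM (subst _ _)) /=.
move: Hu Hv.
move: (subst p q f) (subst p' q' f) (subst p q g) (subst p' q' g) => F F' G G'.
move=> Hu Hv; have -> : (u * G + F' * v) * l = (u * l) * G + F' * (v * l) by ring.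
by rewrite -Hu -Hv; ring.
Qed.

(** With [p a + q b = 1] and [t = p x + q y], one has [x = a t] and [y = b t] modulo
    the equation of the line, so [f] is congruent to [f (a t, b t)], which is the
    restriction of [f] with [t] substituted for the parameter. *)
Lemma line_dvd a b f :
  (a != 0) || (b != 0) -> restr a b f = 0 -> divides (line a b) f.
Proof.
move=> ab0 f0.
have [p [q pq1]] : exists p q : C, p * a + q * b = 1.
  case/orP: ab0 => h; [exists a^-1, 0|exists 0, b^-1].
    by rewrite mulVf // mul0r addr0.
  by rewrite mulVf // mul0r add0r.
pose t : pol := p%:MP * x + q%:MP * y.
have pq1' : p%:MP * a%:MP + q%:MP * b%:MP = 1 :> pol.
  by rewrite -!mpolyCM -mpolyCD pq1 mpolyC1.
have : subst t y (restr a b f) = 0 by rewrite f0 rmorph0.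
rewrite /restr subst_comp !rmorphM /= !substC substx => ft0.
rewrite -[f]subst_id -[subst x y f]subr0 -ft0; apply: subst_congr.
  exists q%:MP; rewrite /line /t -[X in X - _]mul1r -pq1'; ring.
exists (- p%:MP); rewrite /line /t -[X in X - _]mul1r -pq1'; ring.
Qed.

(** Distinct lines accumulate: if [p] does not vanish on the line, its equation divides
    the cofactor of [p]. *)
Lemma dvd_line_mul a b p f : (a != 0) || (b != 0) ->
  restr a b p != 0 -> divides p f -> restr a b f = 0 -> divides (p * line a b) f.
Proof.
move=> ab0 p0 [q ->]; rewrite rmorphM /= => /eqP; rewrite mulf_eq0 (negbTE p0) orbF.
by move=> /eqP /(line_dvd ab0) [r ->]; exists r; rewrite mulrA mulrAC.
Qed.

Lemma i_sq : 'i * 'i = -1 :> C.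
Proof. by rewrite -expr2 sqrCi. Qed.

Lemma i_neq0 : 'i != 0 :> C.
Proof. by rewrite -sqrf_eq0 sqrCi oppr_eq0 oner_neq0. Qed.

Lemma i_neq1 : 'i != 1 :> C.
Proof.
apply/eqP => h; have /eqP := i_sq; rewrite h mulr1 -subr_eq0 opprK.
by rewrite -(natrD _ 1 1) pnatr_eq0.
Qed.

Lemma i_pow_neq1 k : (0 < k < 4)%N -> 'i ^+ k != 1 :> C.
Proof.
case: k => [|[|[|[|//]]]] // _; first exact: i_neq1.
  by rewrite sqrCi eq_sym -subr_eq0 opprK -(natrD _ 1 1) pnatr_eq0.
apply/eqP=> /(congr1 (fun u => u * 'i)); rewrite -exprSr (exprM _ 2 2) sqrCi mul1r.
by rewrite expr2 mulN1r opprK => /eqP; rewrite eq_sym; apply/negP/i_neq1.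
Qed.

(** Apart from [x = 0] and [y = 0], the lines of [Gamma] and [Delta] come in quadruples
    spanned by the [(z, i^k)], which [D] permutes; the product of four such equations is [x^4 - z^4 y^4] up to sign. *)
Lemma dvd_quartic z p f : z != 0 ->
  (forall k, restr z ('i ^+ k) p != 0) -> divides p f ->
  (forall k, restr z ('i ^+ k) f = 0) ->
  divides (p * (x ^+ 4 - (z ^+ 4)%:MP * y ^+ 4)) f.
Proof.
move=> z0 p0 pf f0.
have zi k : (z != 0) || ('i ^+ k != 0 :> C) by rewrite z0.
have nz k l : (k < l)%N -> (l < 4)%N -> restr z ('i ^+ l) (line z ('i ^+ k)) != 0.
  move=> kl l4; rewrite restr_line mulf_neq0 ?x_neq0 // mpolyC_eq0.
  rewrite [_ * z]mulrC -mulrBr mulf_neq0 // -(subnKC (ltnW kl)) exprD.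
  rewrite -{1}['i ^+ k]mulr1 -mulrBr mulf_neq0 ?expf_neq0 ?i_neq0 // subr_eq0 eq_sym.
  have: (0 < l - k < 4)%N by rewrite subn_gt0 kl (leq_ltn_trans (leq_subr _ _) l4).
  exact: i_pow_neq1.
have h0 := dvd_line_mul (zi 0%N) (p0 0%N) pf (f0 0%N).
have h1 := dvd_line_mul (zi 1%N) _ h0 (f0 1%N).
have h2 := dvd_line_mul (zi 2) _ (h1 _) (f0 2).
have h3 := dvd_line_mul (zi 3) _ (h2 _ _) (f0 3).
have [|||q ->] := h3; try by rewrite !rmorphM /= !mulf_neq0 ?nz ?p0.
exists (- q); rewrite /line.
have i2 : 'i%:MP * 'i%:MP = -1 :> pol by rewrite -mpolyCM i_sq mpolyCN mpolyC1.
rewrite !rmorphXn /=.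
ring: i2.
Qed.

(** * Relative invariants of the group *)

Lemma s_sq : s * s = 2. Proof. by rewrite -expr2 sqrtCK. Qed.

Lemma s_neq0 : s != 0. Proof. by rewrite sqrtC_eq0 pnatr_eq0. Qed.

Lemma matTE : T = mx22 s^-1 s^-1 s^-1 (- s^-1).
Proof.
apply/matrixP => i j; rewrite !mxE; do 2?case: ifP => _; rewrite ?mulr1 //.
by rewrite mulrN1.
Qed.

Lemma restr_T a b f :
  restr a b (act T f) = restr (s^-1 * (a + b)) (s^-1 * (a - b)) f.
Proof. by rewrite restr_act matTE !mxE /= mulrDr mulrBr mulNr. Qed.

Lemma restr_D a b f : restr a b (act D f) = restr a ('i * b) f.
Proof. by rewrite restr_act !mxE /= !mul0r mul1r addr0 add0r. Qed.

Lemma vanish_T e a b f : act T f = e%:MP * f ->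
  restr a b f = 0 -> restr (a + b) (a - b) f = 0.
Proof.
move=> Tf f0; have := restr_T a b f; rewrite Tf rmorphM /= f0 mulr0.
by move/esym/(restr_scale s); rewrite !mulrA divff ?s_neq0 // !mul1r.
Qed.

Lemma vanish_D e a b f : act D f = e%:MP * f ->
  restr a b f = 0 -> forall k, restr a ('i ^+ k * b) f = 0.
Proof.
move=> Df f0; elim=> [|k IH]; first by rewrite mul1r.
by rewrite exprS -mulrA -restr_D Df rmorphM /= IH mulr0.
Qed.

Lemma restr_quartic z k c :
  restr z ('i ^+ k) (x ^+ 4 - c%:MP * y ^+ 4) = (z ^+ 4 - c)%:MP * x ^+ 4.
Proof.
have i4 : ('i ^+ k)%:MP ^+ 4 = 1 :> pol.
  rewrite -rmorphXn /= -exprM mulnC exprM (exprM _ 2 2) sqrCi sqrrN.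
  by rewrite !expr1n mpolyC1.
rewrite rmorphB (rmorphM _ c%:MP) !rmorphXn /= restrC restrx restry !exprMn i4 mpolyCB.
by rewrite rmorphXn /= mul1r mulrBl.
Qed.

Lemma restr_proportional c a b a' b' (f : pol) :
  restr a b f = 0 -> a' = c * a -> b' = c * b -> restr a' b' f = 0.
Proof. by move=> f0 -> ->; apply: restr_scale. Qed.

Lemma divides1 (f : pol) : divides 1 f. Proof. by exists f; rewrite mulr1. Qed.

Lemma oppr_fixed (f : pol) : - f = f -> f = 0.
Proof.
move=> h; have : (1 + 1)%:MP * f == 0 by rewrite mpolyCD mulrDl mpolyC1 mul1r -{1}h addNr.
by rewrite mulf_eq0 mpolyC_eq0 -(natrD _ 1 1) pnatr_eq0 => /eqP.
Qed.

(** The orbit of the line [y = 0] consists of [x = 0], [y = 0] and the four lines spanned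
    by the [(1, i^k)], and [Gamma] is the product of their equations up to sign. *)
Lemma Gamma_dvd e h f : act T f = e%:MP * f -> act D f = h%:MP * f ->
  restr 1 0 f = 0 -> divides Gamma f.
Proof.
move=> Tf Df f0.
have f1 k : restr 1 ('i ^+ k) f = 0.
  by have := vanish_T Tf f0; rewrite addr0 subr0 => /(vanish_D Df)/(_ k); rewrite mulr1.
have f2 : restr 0 1 f = 0.
  have := vanish_T Tf (f1 2%N); rewrite sqrCi subrr opprK => /(restr_scale (1 + 1)^-1).
  by rewrite mulr0 mulVf // -(natrD _ 1 1) pnatr_eq0.
have n10 : (1 != 0 :> C) || (0 != 0 :> C) by rewrite oner_neq0.
have n01 : (0 != 0 :> C) || (1 != 0 :> C) by rewrite oner_neq0 orbT.
have := dvd_line_mul n10 _ (divides1 f) f0.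
rewrite rmorph1 oner_neq0 => /(_ isT) d1.
have := dvd_line_mul n01 _ d1 f2.
rewrite mul1r restr_line mul0r mul1r sub0r mpolyCN mpolyC1 mulN1r oppr_eq0 x_neq0.
move/(_ isT) => d2.
have [|q ->] := dvd_quartic (oner_neq0 C) _ d2 f1.
  move=> k; rewrite rmorphM /= !restr_line !(mul1r, mulr1, mulr0) subr0 sub0r.
  by rewrite !mulf_neq0 ?x_neq0 ?mpolyC_eq0 ?oppr_eq0 ?oner_neq0 // expf_neq0 ?i_neq0.
exists q; rewrite /line /Gamma expr1n mpolyC1 mpolyC0.
move: x y q => X Y q; ring.
Qed.

(** The reflection [T] fixes the vector [(1 + sqrt 2, 1)], so [f] vanishes on the line it
    spans.  The orbit of this line consists of the quadruples [(z, i^k)] with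
    [z^4 = 17 + 12 sqrt 2], [z^4 = 17 - 12 sqrt 2] and [z^4 = -1], which are the roots of
    [Delta (x, 1) = (z^4 + 1) (z^8 - 34 z^4 + 1)]. *)
Lemma Delta_dvd h f : act T f = - f -> act D f = h%:MP * f -> divides Delta f.
Proof.
move=> Tf Df.
have Tf' : act T f = (-1)%:MP * f by rewrite mpolyCN mpolyC1 mulN1r.
have f1 : restr (1 + s) 1 f = 0.
  have := restr_T (1 + s) 1 f; rewrite Tf rmorphN /= (_ : _ * _ = 1 + s); last first.
    by field: s_sq; exact: s_neq0.
  rewrite (_ : s^-1 * _ = 1); last by field; exact: s_neq0.
  exact: oppr_fixed.
have ns := s_neq0; have n2 : 2 != 0 :> C by rewrite pnatr_eq0.
(* [D^2 T D^2] sends [(1 + s, 1)] to a multiple of [(1 - s, 1)]. *)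
have f2 : restr (1 - s) 1 f = 0.
  apply: (restr_proportional (c := (1 - s) / s) (vanish_D Df (vanish_T Tf' (vanish_D Df f1 2)) 2)).
    by rewrite sqrCi; field.
  by rewrite sqrCi; field: s_sq.
(* [T D] sends it to a multiple of [((1 + i) / s, 1)]. *)
have f3 : restr ((1 + 'i) / s) 1 f = 0.
  apply: (restr_proportional (c := (1 + s + 'i) * (s - 1) / 2 / s) (vanish_T Tf' (vanish_D Df f1 1))).
    by field: s_sq i_sq; rewrite ?ns ?n2.
  by field: s_sq i_sq; rewrite ?ns ?n2.
have e1 : (1 + s) ^+ 4 = 17 + 12 * s by ring: s_sq.
have e2 : (1 - s) ^+ 4 = 17 - 12 * s by ring: s_sq.
have e3 : ((1 + 'i) / s) ^+ 4 = -1 by field: s_sq i_sq; exact: s_neq0.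
have s_gt0 : 0 < s by rewrite sqrtC_gt0 ltr0n.
have z1 : 1 + s != 0 by rewrite lt0r_neq0 // addr_gt0.
have z2 : 1 - s != 0.
  have : (1 - s) * (1 + s) != 0 by rewrite (_ : _ * _ = -1) ?oppr_eq0 ?oner_eq0 //; ring: s_sq.
  by rewrite mulf_eq0 negb_or => /andP[].
have z3 : (1 + 'i) / s != 0.
  by apply: contra_eq_neq e3 => ->; rewrite expr0n eq_sym oppr_eq0 oner_eq0.
have F z : restr z 1 f = 0 -> forall k, restr z ('i ^+ k) f = 0.
  by move=> fz k; have := vanish_D Df fz k; rewrite mulr1.
have X4 c : c != 0 -> c%:MP * x ^+ 4 != 0.
  by move=> c0; rewrite mulf_neq0 ?expf_neq0 ?x_neq0 // mpolyC_eq0.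
have d1 : divides (1 * (x ^+ 4 - ((1 + s) ^+ 4)%:MP * y ^+ 4)) f.
  apply: (dvd_quartic z1 _ (divides1 f) (F _ f1)) => k.
  by rewrite rmorph1 oner_neq0.
have d2 := dvd_quartic z2 _ d1 (F _ f2).
have d3 := dvd_quartic z3 _ (d2 _) (F _ f3).
have [k|k|q ->] := d3; rewrite mul1r.
- rewrite rmorphM /= !restr_quartic mulf_neq0 // X4 // e3 ?e1 ?e2.
    rewrite (_ : _ - _ = - (18 + 12 * s)); last by ring.
    by rewrite oppr_eq0 lt0r_neq0 // addr_gt0 ?mulr_gt0 ?ltr0n.
  rewrite (_ : _ - _ = - (18 - 12 * s)); last by ring.
  have : (18 - 12 * s) * (18 + 12 * s) != 0.
    by rewrite (_ : _ * _ = 36%:R) ?pnatr_eq0 //; ring: s_sq.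
  by rewrite oppr_eq0 mulf_eq0 negb_or => /andP[].
- rewrite restr_quartic X4 // e1 e2 (_ : _ - _ = - (24 * s)); last by ring.
  by rewrite oppr_eq0 mulf_neq0 ?s_neq0 ?pnatr_eq0.
exists q; rewrite e1 e2 e3 /Delta.
have ss : s%:MP * s%:MP = 2 :> pol by rewrite -mpolyCM s_sq rmorph_nat.
move: x y q => X Y q; ring: ss.
Qed.

(** In the identities for [T], a polynomial of degree [2n] picks up [r^(2n)] and an integer
    factor [2^n], which cancel by the following equation. *)
Lemma r_sq : 2 * r ^+ 2 = 1 :> pol.
Proof.
rewrite -(rmorph_nat (@mpolyC 2 C)) -rmorphXn -rmorphM /= exprVn sqrtCK divff ?mpolyC1 //.
by rewrite pnatr_eq0.
Qed.

Lemma actTx : act T x = r * (x + y).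
Proof. by rewrite actx matTE !mxE mulrDr. Qed.

Lemma actTy : act T y = r * (x - y).
Proof. by rewrite acty matTE !mxE /= mpolyCN mulNr mulrBr. Qed.

Lemma actDx : act D x = x.
Proof. by rewrite actx !mxE /= mpolyC1 mpolyC0 mul0r addr0 mul1r. Qed.

Lemma actDy : act D y = 'i%:MP * y.
Proof. by rewrite acty !mxE /= mpolyC0 mul0r add0r. Qed.

Lemma i_sqC : 'i%:MP ^+ 2 = -1 :> pol.
Proof. by rewrite -rmorphXn /= sqrCi mpolyCN mpolyC1. Qed.

Definition theta : pol := x ^+ 8 + (x ^+ 4 * y ^+ 4) *+ 14 + y ^+ 8.

Lemma act_Gamma g :
  act g Gamma = - act g x ^+ 5 * act g y + act g x * act g y ^+ 5.
Proof. by rewrite /Gamma; ring. Qed.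

Lemma act_Delta g :
  act g Delta = act g x ^+ 12 - (act g x ^+ 8 * act g y ^+ 4) *+ 33
                    - (act g x ^+ 4 * act g y ^+ 8) *+ 33 + act g y ^+ 12.
Proof. by rewrite /Delta; ring. Qed.

Lemma act_theta g :
  act g theta = act g x ^+ 8 + (act g x ^+ 4 * act g y ^+ 4) *+ 14 + act g y ^+ 8.
Proof. by rewrite /theta; ring. Qed.

Lemma act_T_Gamma : act T Gamma = Gamma.
Proof.
rewrite act_Gamma actTx actTy /Gamma; move: x y r r_sq => X Y q hq.
by rewrite -[RHS]mul1r -[1 in RHS](expr1n _ 3) -hq; ring.
Qed.

Lemma act_D_Gamma : act D Gamma = 'i%:MP * Gamma.
Proof.
rewrite act_Gamma actDx actDy /Gamma; move: x y ('i%:MP) i_sqC => X Y z hz.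
by ring: hz.
Qed.

Lemma act_T_Delta : act T Delta = - Delta.
Proof.
rewrite act_Delta actTx actTy /Delta; move: x y r r_sq => X Y q hq.
by rewrite -[RHS]mul1r -[1 in RHS](expr1n _ 6) -hq; ring.
Qed.

Lemma act_D_Delta : act D Delta = Delta.
Proof.
rewrite act_Delta actDx actDy /Delta; move: x y ('i%:MP) i_sqC => X Y z hz.
by ring: hz.
Qed.

Lemma act_T_theta : act T theta = theta.
Proof.
rewrite act_theta actTx actTy /theta; move: x y r r_sq => X Y q hq.
by rewrite -[RHS]mul1r -[1 in RHS](expr1n _ 4) -hq; ring.
Qed.

Lemma act_D_theta : act D theta = theta.
Proof.
rewrite act_theta actDx actDy /theta; move: x y ('i%:MP) i_sqC => X Y z hz.
by ring: hz.
Qed.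

(** * From the generators to the group *)

Lemma det2 (R : comNzRingType) (A : 'M[R]_2) : \det A = A 0 0 * A 1 1 - A 0 1 * A 1 0.
Proof.
rewrite (expand_det_row _ 0) big_ord_recl big_ord1 /cofactor !det_mx11 !mxE /=.
rewrite expr0 expr1 mul1r mulN1r mulrN; congr (_ * A _ _ - A _ _ * A _ _); exact/val_inj.
Qed.

Lemma T_unit : T \in unitmx.
Proof.
have TT : T *m T = 1%:M.
  apply/matrixP => i j; rewrite mulmx2E matTE !mxE -!val_eqE.
  have ns := s_neq0.
  by case: i j => [[|[|//]] ?] [[|[|//]] ?] /=; field: s_sq.
by case/mulmx1_unit: TT.
Qed.

Lemma D_unit : D \in unitmx.
Proof.
by rewrite unitmxE det2 !mxE /= mul1r mul0r subr0 unitfE i_neq0.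
Qed.

Lemma in_G_unit (g : 'M[C]_2) : in_G g -> g \in unitmx.
Proof.
elim=> {g} [|||g h _ ug _ uh|g _ ug]; first exact: T_unit.
- exact: D_unit.
- exact: unitmx1.
- by rewrite unitmx_mul ug.
by rewrite unitmx_inv.
Qed.

Lemma map_actM m n (g h : 'M[C]_2) (F : 'M[pol]_(m, n)) :
  map_mx (act (g *m h)) F = map_mx (act h) (map_mx (act g) F).
Proof. by apply/matrixP => i j; rewrite !mxE actM. Qed.

Lemma map_act1 m n (F : 'M[pol]_(m, n)) : map_mx (@act C 1%:M) F = F.
Proof. by apply/matrixP => i j; rewrite !mxE act1. Qed.

Lemma map_act_const m n p g (A : 'M[C]_(m, n)) (F : 'M[pol]_(n, p)) :
  map_mx (act g) (cst A *m F) = cst A *m map_mx (act g) F.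
Proof.
rewrite map_mxM; congr (_ *m _); apply/matrixP => i j; rewrite !mxE; exact: actC.
Qed.

(** For the inverse of [g], apply [act (invmx g)] to the equation for [g]. *)
Lemma equivariant_ind m n (rho : 'M[C]_2 -> 'M[C]_m) (F : 'M[pol]_(m, n)) :
  representation rho ->
  map_mx (act T) F = cst (rho T) *m F -> map_mx (act D) F = cst (rho D) *m F ->
  forall g, in_G g -> map_mx (act g) F = cst (rho g) *m F.
Proof.
move=> [ru rM] FT FD; have r1 : rho 1%:M = 1%:M.
  have u1 := ru _ (in_G_1 C); have := rM _ _ (in_G_1 C) (in_G_1 C).
  by rewrite mulmx1 => /(congr1 (mulmx (invmx (rho 1%:M)))); rewrite mulKmx // mulVmx.
have rV g : in_G g -> rho (invmx g) *m rho g = 1%:M.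
  by move=> Gg; rewrite -rM ?mulVmx ?r1 //; [exact: in_G_unit|exact: in_G_inv].
move=> g; elim=> {g} [|||g h Gg IHg Gh IHh|g Gg IHg].
- exact: FT.
- exact: FD.
- by rewrite map_act1 r1 map_mx1 mul1mx.
- by rewrite (map_actM g h) IHg map_act_const IHh (rM _ _ Gg Gh) map_mxM mulmxA.
rewrite -[LHS]mul1mx -(map_mx1 (@mpolyC 2 C)) -(rV g Gg) map_mxM -mulmxA.
rewrite -map_act_const -IHg -map_actM mulmxV ?map_act1 //; exact: in_G_unit.
Qed.

Lemma invariant_gen f : act T f = f -> act D f = f -> invariant f.
Proof.
move=> fT fD g; elim=> {g} [|||g h _ fg _ fh|g Gg fg].
- exact: fT.
- exact: fD.
- exact: act1.
- by rewrite (actM g h) fg.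
by rewrite -{1}fg -(actM g) mulmxV ?act1 //; exact: in_G_unit.
Qed.

Opaque act.

Lemma cst_adj (A : 'M[C]_2) (U : 'M[pol]_2) i j :
  (cst A *m U *m \adj U) i j = (A i j)%:MP * \det U.
Proof.
by rewrite -mulmxA mul_mx_adj mul_mx_scalar !mxE mulrC.
Qed.

(** If [act g U = A U] then [act g U * adj U = (det U) A], so [A] is read off at any
    monomial of [det U], here the leading one. *)
Definition coef_rep (U : 'M[pol]_2) (g : 'M[C]_2) : 'M[C]_2 :=
  \matrix_(i, j) (((map_mx (act g) U *m \adj U) i j)@_(mlead (\det U)) / mleadc (\det U)).

Lemma coef_repE (U : 'M[pol]_2) (g A : 'M[C]_2) : \det U != 0 ->
  map_mx (act g) U = cst A *m U -> coef_rep U g = A.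
Proof.
move=> U0 gU; apply/matrixP => i j; rewrite mxE gU cst_adj mul_mpolyC mcoeffZ mulfK //.
by rewrite mleadc_eq0.
Qed.

(** The matrix [A] with [act g U = A U] exists for all [g] by induction from the
    generators, and is unique because [det U] is not zero; uniqueness makes it
    multiplicative. *)
Lemma exists_rep (U : 'M[pol]_2) (A B : 'M[C]_2) :
  \det U != 0 -> A \in unitmx -> B \in unitmx ->
  map_mx (act T) U = cst A *m U -> map_mx (act D) U = cst B *m U ->
  exists rho : 'M[C]_2 -> 'M[C]_2, [/\ representation rho, rho T = A & rho D = B].
Proof.
move=> U0 uA uB UT UD.
have ex g : in_G g -> exists2 M : 'M[C]_2, M \in unitmx & map_mx (act g) U = cst M *m U.
  elim=> {g} [|||g h _ [M uM IHg] _ [N uN IHh]|g Gg [M uM IHg]].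
  - by exists A.
  - by exists B.
  - by exists 1%:M; rewrite ?unitmx1 // map_act1 map_mx1 mul1mx.
  - exists (M *m N); first by rewrite unitmx_mul uM.
    by rewrite (map_actM g h) IHg map_act_const IHh map_mxM mulmxA.
  exists (invmx M); first by rewrite unitmx_inv.
  have U_E : U = cst M *m map_mx (act (invmx g)) U.
    by rewrite -map_act_const -IHg -(map_actM g) mulmxV ?map_act1 // in_G_unit.
  by rewrite [in RHS]U_E mulmxA -map_mxM mulVmx // map_mx1 mul1mx.
exists (coef_rep U); split; [|exact: coef_repE|exact: coef_repE].
split=> [g /ex[M uM gU]|g h /ex[M _ gU] /ex[N _ hU]]; first by rewrite (coef_repE U0 gU).
rewrite (coef_repE U0 gU) (coef_repE U0 hU); apply: coef_repE => //.
by rewrite (map_actM g h) gU map_act_const hU map_mxM mulmxA.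
Qed.

Opaque restr.

(** * The determinant of two equivariants *)

Lemma x_pow_neq0 (c : C) n : c != 0 -> c%:MP * x ^+ n != 0 :> pol.
Proof. by move=> c0; rewrite mulf_neq0 ?expf_neq0 ?x_neq0 // mpolyC_eq0. Qed.

Lemma restr_Gamma a b : restr a b Gamma = (a * b ^+ 5 - a ^+ 5 * b)%:MP * x ^+ 6.
Proof.
have -> : restr a b Gamma = - restr a b x ^+ 5 * restr a b y + restr a b x * restr a b y ^+ 5.
  by rewrite /Gamma; ring.
by rewrite restrx restry; ring.
Qed.

Lemma restr_Delta a : restr a 0 Delta = (a ^+ 12)%:MP * x ^+ 12.
Proof.
have -> : restr a 0 Delta =
    restr a 0 x ^+ 12 - (restr a 0 x ^+ 8 * restr a 0 y ^+ 4) *+ 33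
    - (restr a 0 x ^+ 4 * restr a 0 y ^+ 8) *+ 33 + restr a 0 y ^+ 12.
  by rewrite /Delta; ring.
by rewrite restrx restry; ring.
Qed.

Lemma restr_theta a : restr a 0 theta = (a ^+ 8)%:MP * x ^+ 8.
Proof.
have -> : restr a 0 theta =
    restr a 0 x ^+ 8 + (restr a 0 x ^+ 4 * restr a 0 y ^+ 4) *+ 14 + restr a 0 y ^+ 8.
  by rewrite /theta; ring.
by rewrite restrx restry; ring.
Qed.

Lemma Gamma_neq0 : Gamma != 0.
Proof.
have : restr 1 2 Gamma != 0.
  rewrite restr_Gamma x_pow_neq0 // (_ : _ - _ = 30%:R) ?pnatr_eq0 //; ring.
by apply: contra_neq => ->; rewrite rmorph0.
Qed.

Lemma Delta_neq0 : Delta != 0.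
Proof.
have : restr 1 0 Delta != 0 by rewrite restr_Delta x_pow_neq0 // expr1n oner_neq0.
by apply: contra_neq => ->; rewrite rmorph0.
Qed.

Lemma act_quot (g : 'M[C]_2) (c d : C) (p q : pol) : p != 0 -> d != 0 ->
  act g p = d%:MP * p -> act g (q * p) = c%:MP * (q * p) -> act g q = (c / d)%:MP * q.
Proof.
move=> p0 d0 gp; rewrite rmorphM /= gp => h.
apply: (mulIf (_ : d%:MP * p != 0)); first by rewrite mulf_neq0 // mpolyC_eq0.
rewrite h (_ : c%:MP = (c / d)%:MP * d%:MP); last by rewrite -mpolyCM divfK.
by rewrite -!mulrA [d%:MP * _]mulrCA.
Qed.

Lemma y_dvd (f : pol) : restr 1 0 f = 0 -> divides y f.
Proof.
have n10 : (1 != 0 :> C) || (0 != 0 :> C) by rewrite oner_neq0.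
move=> /(line_dvd n10)[q ->]; exists (- q).
by rewrite /line mpolyC0 mpolyC1 mul0r mul1r sub0r mulrN mulNr.
Qed.

Lemma restr_y (f : pol) : restr 1 0 (f * y) = 0.
Proof. by rewrite rmorphM /= restry mpolyC0 mul0r mulr0. Qed.

(** The linear form [y] is prime, and [p] is not divisible by it. *)
Lemma y_pow_prime k (p f : pol) : restr 1 0 p != 0 ->
  divides (y ^+ k) (f * p) -> divides (y ^+ k) f.
Proof.
move=> p0; elim: k f => [|k IH] f [q Hq]; first by rewrite expr0; apply: divides1.
have : restr 1 0 (f * p) = 0 by rewrite Hq exprSr mulrA restr_y.
rewrite rmorphM /= => /eqP; rewrite mulf_eq0 (negbTE p0) orbF => /eqP/y_dvd[f1 f1E].
have [|q1 q1E] := IH f1; last by exists q1; rewrite f1E q1E exprSr mulrA.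
exists q; apply: (mulIf y_neq0); rewrite mulrAC -f1E Hq exprSr mulrA //.
Qed.

(** On the line [y = 0], fixed by [D], the equation reads [f = i^a f]; so [f] vanishes there
    unless [a = 0], and dividing [f] by [y] lowers the exponent [a] by one. *)
Lemma D_eigen_y_pow a (f : pol) : (a < 4)%N -> act D f = ('i ^+ a)%:MP * f ->
  divides (y ^+ a) f.
Proof.
elim: a f => [|a IH] f a4 Df; first by rewrite expr0; apply: divides1.
have n1 : 'i ^+ a.+1 != 1 :> C by apply: i_pow_neq1.
have := restr_D 1 0 f; rewrite mulr0 Df rmorphM /= restrC => /eqP.
rewrite -subr_eq0 -{2}[restr 1 0 f]mul1r -mulrBl mulf_eq0 -mpolyC1 -mpolyCB mpolyC_eq0.
rewrite subr_eq0 (negbTE n1) => /eqP/y_dvd[f1 f1E]; rewrite f1E in Df *.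
have := act_quot y_neq0 i_neq0 actDy Df.
rewrite exprSr mulfK ?i_neq0 // => /(IH _ (ltnW a4))[q ->].
by exists q; rewrite exprSr mulrA.
Qed.

(** Dividing by [Gamma] removes exactly one factor [y] and leaves a relative invariant. *)
Lemma Gamma_pow_dvd k e h (f : pol) :
  act T f = e%:MP * f -> act D f = h%:MP * f ->
  divides (y ^+ k) f -> divides (Gamma ^+ k) f.
Proof.
elim: k e h f => [|k IH] e h f Tf Df; first by rewrite !expr0.
case=> q fE; have := Gamma_dvd Tf Df.
rewrite {1}fE exprSr mulrA restr_y => /(_ erefl)[f1 f1E].
have TG : act T Gamma = 1%:MP * Gamma by rewrite mpolyC1 mul1r act_T_Gamma.
rewrite f1E in Tf Df.
have Tf1 := act_quot Gamma_neq0 (oner_neq0 C) TG Tf.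
have Df1 := act_quot Gamma_neq0 i_neq0 act_D_Gamma Df.
have [|q1 q1E] := IH _ _ _ Tf1 Df1; last by exists q1; rewrite f1E q1E exprSr mulrA.
(* [Gamma = y * (x y^4 - x^5)], and the second factor is prime to [y]. *)
apply: (@y_pow_prime _ (x * y ^+ 4 - x ^+ 5)).
  have -> : restr 1 0 (x * y ^+ 4 - x ^+ 5) = (-1)%:MP * x ^+ 5; last first.
    by rewrite x_pow_neq0 // oppr_eq0 oner_neq0.
  have -> : restr 1 0 (x * y ^+ 4 - x ^+ 5) =
     restr 1 0 x * restr 1 0 y ^+ 4 - restr 1 0 x ^+ 5 by ring.
  by rewrite restrx restry; ring.
exists q; apply: (mulIf y_neq0); rewrite -[RHS]mulrA -exprSr -fE f1E /Gamma.
by move: x y => X Y; ring.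
Qed.

Definition equivariant (A B : 'M[C]_2) (F : 'cV[pol]_2) : Prop :=
  map_mx (act T) F = cst A *m F /\ map_mx (act D) F = cst B *m F.

Definition columns (u : 'I_2 -> 'cV[pol]_2) : 'M[pol]_2 := \matrix_(a, b) u b a 0.

Definition duo (F G : 'cV[pol]_2) (b : 'I_2) : 'cV[pol]_2 := if b == 0 then F else G.

Lemma columns_equiv A u g : (forall b, map_mx (act g) (u b) = cst A *m u b) ->
  map_mx (act g) (columns u) = cst A *m columns u.
Proof.
move=> h; apply/matrixP => a b; have /matrixP/(_ a 0) := h b; rewrite !mxE => ->.
by apply: eq_bigr => c _; rewrite !mxE.
Qed.

Lemma det_duo F G : \det (columns (duo F G)) = F 0 0 * G 1 0 - G 0 0 * F 1 0.
Proof. by rewrite det2 !mxE. Qed.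

Lemma act_det A u g : map_mx (act g) (columns u) = cst A *m columns u ->
  act g (\det (columns u)) = (\det A)%:MP * \det (columns u).
Proof. by move=> h; rewrite -det_map_mx h det_mulmx det_map_mx. Qed.

Definition diag2 (a b : nat) : 'M[C]_2 := mx22 ('i ^+ a) 0 0 ('i ^+ b).

(** The components of [F] and [G] are divisible by [y^a] and [y^b]; this forces the power
    of [Gamma], and [det A = -1] then forces the factor [Delta].  The exponent [a + b] may
    exceed [3], so it cannot be read off from the character [det rho] alone. *)
Lemma det_equivariant A a b F G : \det A = -1 -> (a < 4)%N -> (b < 4)%N ->
  equivariant A (diag2 a b) F -> equivariant A (diag2 a b) G ->
  exists2 q, invariant q &
    \det (columns (duo F G)) = q * (Delta * Gamma ^+ (a + b)).
Proof.
move=> dA a4 b4 [TF DF] [TG DG].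
have /act_det Tf : map_mx (act T) (columns (duo F G)) = cst A *m columns (duo F G).
  by apply: columns_equiv => c; rewrite /duo; case: ifP.
have /act_det Df : map_mx (act D) (columns (duo F G)) = cst (diag2 a b) *m columns (duo F G).
  by apply: columns_equiv => c; rewrite /duo; case: ifP.
set f := \det _ in Tf Df *.
rewrite dA in Tf; rewrite det2 !mxE /= mul0r subr0 -exprD in Df.
have comp0 (H : 'cV[pol]_2) : map_mx (act D) H = cst (diag2 a b) *m H -> divides (y ^+ a) (H 0 0).
  move=> /matrixP/(_ 0 0); rewrite mulmx2E !mxE /= mpolyC0 mul0r addr0.
  exact: D_eigen_y_pow.
have comp1 (H : 'cV[pol]_2) : map_mx (act D) H = cst (diag2 a b) *m H -> divides (y ^+ b) (H 1 0).
  move=> /matrixP/(_ 1 0); rewrite mulmx2E !mxE /= mpolyC0 mul0r add0r.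
  exact: D_eigen_y_pow.
have yf : divides (y ^+ (a + b)) f.
  rewrite /f det_duo; have [p1 ->] := comp0 _ DF; have [p2 ->] := comp0 _ DG.
  have [p3 ->] := comp1 _ DF; have [p4 ->] := comp1 _ DG.
  by exists (p1 * p4 - p2 * p3); rewrite exprD; ring.
have [f1 f1E] := Gamma_pow_dvd Tf Df yf; rewrite f1E in Tf Df *.
have G0 : Gamma ^+ (a + b) != 0 by rewrite expf_neq0 // Gamma_neq0.
have n1 : -1 != 0 :> C by rewrite oppr_eq0 oner_neq0.
have Tf1 : act T f1 = - f1.
  have := act_quot G0 (oner_neq0 C) _ Tf; rewrite divr1 mpolyCN mpolyC1 mulN1r; apply.
  by rewrite mul1r rmorphXn /= act_T_Gamma.
have Df1 : act D f1 = 1%:MP * f1.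
  have i0 : 'i ^+ (a + b) != 0 :> C by rewrite expf_neq0 // i_neq0.
  rewrite -(divff i0); apply: act_quot Df => //.
  by rewrite rmorphXn /= act_D_Gamma exprMn rmorphXn.
have [q qE] := Delta_dvd Tf1 Df1; rewrite qE in Tf1 Df1 *.
exists q; last by rewrite mulrA.
apply: invariant_gen.
  have TDelta : act T Delta = (-1)%:MP * Delta.
    by rewrite act_T_Delta mpolyCN mpolyC1 mulN1r.
  have Tq : act T (q * Delta) = (-1)%:MP * (q * Delta).
    by rewrite Tf1 mpolyCN mpolyC1 mulN1r.
  by have := act_quot Delta_neq0 n1 TDelta Tq; rewrite divff // mpolyC1 mul1r.
have DDelta : act D Delta = 1%:MP * Delta by rewrite act_D_Delta mpolyC1 mul1r.
have := act_quot Delta_neq0 (oner_neq0 C) DDelta Df1.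
by rewrite divr1 mpolyC1 mul1r.
Qed.

(** * Homogeneous invariants *)

Lemma pihomogM k e (p q : pol) : p \is e.-homog ->
  pihomog mdeg (k + e)%N (q * p) = pihomog mdeg k q * p.
Proof.
move=> ph; pose N := maxn k.+1 (mmeasure mdeg q).
have -> : q * p = \sum_(j < N) pihomog mdeg j q * p.
  by rewrite -mulr_suml -pihomog_partitionE // leq_maxr.
rewrite linear_sum /= (bigD1 (Ordinal (leq_maxl _ _ : (k < N)%N))) //= big1 => [|j jk].
  by rewrite addr0 pihomog_dE // dhomogM // pihomogP.
rewrite (@pihomog_ne0 _ _ mdeg (j + e)%N) ?eqn_add2r //; last by rewrite dhomogM // pihomogP.
Qed.

Lemma dhomog_quot d e (p q : pol) : p != 0 -> p \is e.-homog -> q * p \is d.-homog ->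
  ((e <= d)%N -> q \is (d - e).-homog) /\ ((d < e)%N -> q = 0).
Proof.
move=> p0 ph qph.
have q0 k : (k + e)%N != d -> pihomog mdeg k q = 0.
  move=> kd; apply: (mulIf p0); rewrite mul0r -(pihomogM _ _ ph).
  by apply: pihomog_ne0 qph; rewrite eq_sym.
split=> de; rewrite (pihomog_partitionE (leqnn _ : (mmeasure mdeg q <= _)%N)).
  rewrite rpred_sum // => j _; have [je|/q0 ->] := eqVneq (j + e)%N d; last exact: rpred0.
  by rewrite -je addnK pihomogP.
by rewrite big1 // => j _; rewrite q0 // gtn_eqF // (leq_trans de) ?leq_addl.
Qed.

Lemma restr_homog e (f : pol) : f \is e.-homog ->
  exists k, forall c, restr c 0 f = (k * c ^+ e)%:MP * x ^+ e.
Proof.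
move=> /dhomogP fh; exists (\sum_(m <- msupp f) f@_m * 0 ^+ m 1) => c.
rewrite [restr _ _ _]comp_mpolyE mulr_suml rmorph_sum /= mulr_suml big_seq [RHS]big_seq.
apply: eq_bigr => m mf; rewrite big_ord_recl big_ord1 /= (_ : lift _ _ = 1); last exact/val_inj.
rewrite !(tnth_nth 0) /= mpolyC0 mul0r -mul_mpolyC.
have : mdeg m = e by exact: fh.
rewrite mdegE big_ord_recl big_ord1 (_ : lift _ _ = 1); last exact/val_inj.
case: (m 1) => [|n] <-; last by rewrite !exprS !mul0r !mulr0 mul0r mpolyC0 mul0r.
by rewrite addn0 !expr0 !mulr1 exprMn mpolyCM mulrA rmorphXn.
Qed.

Lemma sign1_even n : (-1) ^+ n = 1 :> C -> ~~ odd n.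
Proof.
rewrite -signr_odd; case: odd => //= /eqP.
by rewrite eq_sym -subr_eq0 opprK -(natrD _ 1 1) pnatr_eq0.
Qed.

(** Here [z] is a primitive eighth root of unity. *)
Lemma zeta8_exp (z : C) e : z ^+ 4 = -1 -> z ^+ e = 1 -> (8 %| e)%N.
Proof.
move=> z4 ze; have : ~~ odd e by apply: sign1_even; rewrite -z4 -exprM mulnC exprM ze expr1n.
move=> /even_halfK e2; have : ~~ odd e./2.
  apply: sign1_even; rewrite -z4 -exprM (_ : (4 * e./2)%N = (e * 2)%N).
    by rewrite exprM ze expr1n.
  by rewrite -{2}e2 -muln2 -mulnA mulnC.
move=> /even_halfK e4; have : ~~ odd e./2./2.
  apply: sign1_even; rewrite -z4 -exprM (_ : (4 * e./2./2)%N = e) //.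
  by rewrite -{2}e2 -{2}e4 -!muln2 -mulnA mulnC.
move=> /even_halfK e8; rewrite -e2 -e4 -e8 -!muln2 -!mulnA dvdn_mull //.
Qed.

(** The group element [(T D)^3] is the scalar [(1 + i) / sqrt 2]; it is applied here to the
    vector [(1, 0)] only. *)
Lemma invariant_zeta e (f : pol) : invariant f -> f \is e.-homog ->
  restr 1 0 f != 0 -> (8 %| e)%N.
Proof.
move=> fi fh f0; have [k kE] := restr_homog fh.
have Tf a b : restr a b f = restr (s^-1 * (a + b)) (s^-1 * (a - b)) f.
  by rewrite -{1}(fi _ (in_G_T C)) restr_T.
have Df a b : restr a b f = restr a ('i * b) f.
  by rewrite -{1}(fi _ (in_G_D C)) restr_D.
have ns := s_neq0.
pose z : C := (1 + 'i) / s.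
have fz : restr 1 0 f = restr z 0 f.
  rewrite Tf Df Tf Df Tf; apply: (f_equal2 (fun a b => restr a b f)); rewrite /z.
    by field: s_sq i_sq.
  by field: s_sq i_sq.
apply: (@zeta8_exp z); first by rewrite /z; field: s_sq i_sq.
move: fz f0; rewrite !kE expr1n mulr1 => fz.
rewrite mulf_eq0 negb_or mpolyC_eq0 => /andP[k0 xe0].
move/(mulIf xe0)/eqP: fz; rewrite mpolyC_eq -[X in X == _]mulr1 => /eqP/(mulfI k0)-> //.
Qed.

Lemma invariantD (f g : pol) : invariant f -> invariant g -> invariant (f + g).
Proof. by move=> hf hg h Gh; rewrite rmorphD /= hf // hg. Qed.

Lemma invariantM (f g : pol) : invariant f -> invariant g -> invariant (f * g).
Proof. by move=> hf hg h Gh; rewrite rmorphM /= hf // hg. Qed.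

Lemma invariantC c : invariant (c%:MP : pol).
Proof. by move=> h _; rewrite actC. Qed.

Lemma invariantX (f : pol) n : invariant f -> invariant (f ^+ n).
Proof. by move=> hf h Gh; rewrite rmorphXn /= hf. Qed.

Lemma invariant_theta : invariant theta.
Proof. by apply: invariant_gen; [exact: act_T_theta|exact: act_D_theta]. Qed.

Lemma act_D_Gamma4 : act D (Gamma ^+ 4) = Gamma ^+ 4.
Proof.
rewrite rmorphXn /= act_D_Gamma exprMn (exprM _ 2 2) i_sqC.
by rewrite sqrrN expr1n mul1r.
Qed.

Lemma invariant_Gamma4 : invariant (Gamma ^+ 4).
Proof.
by apply: invariant_gen; [rewrite rmorphXn /= act_T_Gamma|exact: act_D_Gamma4].
Qed.

Lemma homog_x : x \is 1.-homog. Proof. by rewrite dhomogX; apply/eqP; exact: mdeg1. Qed.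
Lemma homog_y : y \is 1.-homog. Proof. by rewrite dhomogX; apply/eqP; exact: mdeg1. Qed.

Lemma homog_xy a b : x ^+ a * y ^+ b \is (a + b).-homog.
Proof.
by rewrite dhomogM // -[X in X.-homog]mul1n dhomogMn ?homog_x ?homog_y.
Qed.

Lemma homog_Gamma : Gamma \is 6.-homog.
Proof.
rewrite /Gamma mulNr rpredD ?rpredN //.
  by have := homog_xy 5 1; rewrite expr1.
by have := homog_xy 1 5; rewrite expr1.
Qed.

Lemma homog_theta : theta \is 8.-homog.
Proof.
apply: rpredD; last exact: (dhomogMn 8 homog_y).
apply: rpredD; first exact: (dhomogMn 8 homog_x).
apply: rpredMn; exact: (homog_xy 4 4).
Qed.

Lemma homog_Delta : Delta \is 12.-homog.
Proof.
apply: rpredD; last exact: (dhomogMn 12 homog_y).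
apply: rpredB; last by apply: rpredMn; exact: (homog_xy 4 8).
apply: rpredB; first exact: (dhomogMn 12 homog_x).
apply: rpredMn; exact: (homog_xy 8 4).
Qed.

(** An invariant without the monomial [x^e] is divisible by [y], hence by [y^4] and by
    [Gamma^4]. *)
Lemma invariant_step e (f : pol) : invariant f -> f \is e.-homog -> restr 1 0 f = 0 ->
  exists f', [/\ invariant f', f = f' * Gamma ^+ 4,
    (24 <= e)%N -> f' \is (e - 24).-homog & (e < 24)%N -> f' = 0].
Proof.
move=> fi fh f0; have Tf := fi _ (in_G_T C); have Df := fi _ (in_G_D C).
have G40 : Gamma ^+ 4 != 0 by rewrite expf_neq0 // Gamma_neq0.
have y4 : divides (y ^+ 4) f.
  have [q qE] := y_dvd f0; have : act D (q * y) = 1%:MP * (q * y).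
    by rewrite -qE Df mpolyC1 mul1r.
  move/(act_quot y_neq0 i_neq0 actDy); have -> : 1 / 'i = 'i ^+ 3 :> C.
    by field: i_sq; exact: i_neq0.
  move=> /(D_eigen_y_pow (isT : (3 < 4)%N))[q1 q1E]; exists q1.
  by rewrite qE q1E [y ^+ 4]exprSr mulrA.
have [||f' f'E] := @Gamma_pow_dvd 4 1 1 f _ _ y4; rewrite ?mpolyC1 ?mul1r //.
exists f'; have [//|||h1 h2] := @dhomog_quot e 24 (Gamma ^+ 4) f'.
- exact: (dhomogMn 4 homog_Gamma).
- by rewrite -f'E.
split=> //; apply: invariant_gen; apply: (mulIf G40).
  by rewrite -f'E -[RHS]Tf f'E rmorphM /= rmorphXn /= act_T_Gamma.
by rewrite -f'E -[RHS]Df f'E rmorphM /= act_D_Gamma4.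
Qed.

Lemma invariant_degree e (f : pol) : invariant f -> f \is e.-homog -> ~~ (8 %| e)%N -> f = 0.
Proof.
elim/ltn_ind: e f => e IH f fi fh e8.
have f0 : restr 1 0 f = 0.
  by apply/eqP; apply: contraR e8; apply: invariant_zeta.
have [f' [f'i -> h1 h2]] := invariant_step fi fh f0.
have [e24|e24] := leqP 24 e; last by rewrite h2 // mul0r.
rewrite (IH (e - 24)%N _ f') ?mul0r ?h1 //; first by rewrite ltn_subrL (leq_trans _ e24).
by rewrite dvdn_subl.
Qed.

(** Dimension and basis of the space of invariants of degree [e]: the monomials of degree
    [e] in [theta], of degree [8], and [Gamma^4], of degree [24]. *)
Definition inv_dim e : nat := if (8 %| e)%N then (e %/ 24).+1 else 0.

Definition inv_basis e i : pol := theta ^+ (e %/ 8 - 3 * i) * Gamma ^+ (4 * i).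

Lemma inv_basisP e i : (i < inv_dim e)%N -> invariant (inv_basis e i) /\ inv_basis e i \is e.-homog.
Proof.
rewrite /inv_dim; case: ifP => // e8; rewrite ltnS => ie; split.
  apply: invariantM; first exact/invariantX/invariant_theta.
  by rewrite exprM; apply/invariantX/invariant_Gamma4.
have e3 : (3 * i <= e %/ 8)%N.
  by rewrite mulnC -leq_divRL // -divnMA.
have eE : e = (8 * (e %/ 8 - 3 * i) + 6 * (4 * i))%N.
  have e24 : (24 * i <= e)%N.
    have : (8 * (3 * i) <= 8 * (e %/ 8))%N by rewrite leq_mul2l.
    by rewrite mulnA [(8 * (e %/ 8))%N]mulnC divnK.
  by rewrite mulnBr [(8 * (e %/ 8))%N]mulnC divnK // !mulnA subnK.
by rewrite [X in X.-homog]eE; apply: dhomogM; apply: dhomogMn; [exact: homog_theta|exact: homog_Gamma].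
Qed.

(** On the line [y = 0] only the term without [Gamma] survives; the others are divisible by
    [Gamma^4]. *)
Lemma theta_Gamma_free n (c : nat -> C) (t : nat -> nat) :
  \sum_(i < n) (c i)%:MP * (theta ^+ t i * Gamma ^+ (4 * i)) = 0 ->
  forall i, (i < n)%N -> c i = 0.
Proof.
elim: n c t => [//|n IH] c t; rewrite big_ord_recl /= muln0 expr0 mulr1 => h.
have G0 : restr 1 0 Gamma = 0.
  by rewrite restr_Gamma expr0n mulr0 mulr0 subr0 mpolyC0 mul0r.
have e : \sum_(i < n) (c (bump 0 i))%:MP * (theta ^+ t (bump 0 i) * Gamma ^+ (4 * bump 0 i))
    = (\sum_(i < n) (c i.+1)%:MP * (theta ^+ t i.+1 * Gamma ^+ (4 * i))) * Gamma ^+ 4.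
  rewrite mulr_suml; apply: eq_bigr => i _.
  by rewrite /bump add1n mulnS addnC exprD !mulrA.
rewrite e in h.
have c0 : c 0%N = 0.
  have := congr1 (restr 1 0) h; rewrite rmorph0; move: (\sum_(i < n) _) => S.
  have rE (a b u v : pol) :
      restr 1 0 (a * b + u * v) = restr 1 0 a * restr 1 0 b + restr 1 0 u * restr 1 0 v.
    by rewrite rmorphD !rmorphM.
  rewrite rE !rmorphXn /=.
  rewrite restrC restr_theta G0 expr0n mulr0 addr0 expr1n mpolyC1 mul1r -exprM => /eqP.
  by rewrite mulf_eq0 mpolyC_eq0 expf_eq0 (negbTE x_neq0) andbF orbF => /eqP.
move: h; rewrite c0 mpolyC0 mul0r add0r => /eqP; rewrite mulf_eq0 expf_eq0 (negbTE Gamma_neq0).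
rewrite andbF orbF => /eqP/(IH (fun i => c i.+1) (fun i => t i.+1)) h [//|i]; exact: h.
Qed.

Lemma inv_span e (f : pol) : invariant f -> f \is e.-homog ->
  exists c : nat -> C, f = \sum_(i < inv_dim e) (c i)%:MP * inv_basis e i.
Proof.
elim/ltn_ind: e f => e IH f fi fh.
have [e8|e8] := boolP (8 %| e)%N; last first.
  by exists (fun=> 0); rewrite (invariant_degree fi fh e8) /inv_dim (negbTE e8) big_ord0.
have [k kE] := restr_homog fh.
have th : theta ^+ (e %/ 8)%N \is e.-homog.
  by rewrite -[X in X.-homog](divnK e8) mulnC dhomogMn // homog_theta.
have ti : invariant (theta ^+ (e %/ 8)%N) by exact/invariantX/invariant_theta.
have gi : invariant (f + (- k)%:MP * theta ^+ (e %/ 8)%N).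
  by apply: invariantD => //; apply: invariantM ti; apply: invariantC.
have gh : f + (- k)%:MP * theta ^+ (e %/ 8)%N \is e.-homog.
  by rewrite rpredD // mul_mpolyC dhomogZ.
have g0 : restr 1 0 (f + (- k)%:MP * theta ^+ (e %/ 8)%N) = 0.
  rewrite rmorphD rmorphM /= restrC rmorphXn /= restr_theta kE !expr1n !mulr1 mul1r.
  by rewrite -exprM mulnC divnK // mpolyCN mulNr subrr.
have [f' [f'i f'E h1 h2]] := invariant_step gi gh g0.
have {}f'E : f = k%:MP * theta ^+ (e %/ 8)%N + f' * Gamma ^+ 4.
  by rewrite -f'E mpolyCN mulNr addrC subrK.
have [e24|e24] := leqP 24 e; last first.
  exists (fun=> k); rewrite /inv_dim e8 divn_small // big_ord1 /inv_basis subn0 mulr1.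
  by rewrite {1}f'E h2 // mul0r addr0.
have e'8 : (8 %| e - 24)%N by rewrite dvdn_subl.
have [|c cE] := IH (e - 24)%N _ f' f'i (h1 e24); first by rewrite ltn_subrL (leq_trans _ e24).
exists (fun i => if i is j.+1 then c j else k).
rewrite {1}f'E cE /inv_dim e8 e'8; rewrite [in RHS]big_ord_recl /inv_basis subn0 mulr1.
have -> : (e %/ 24)%N = ((e - 24) %/ 24).+1.
  by rewrite -{1}(subnK e24) divnDr // divnn addn1.
congr (_ + _); rewrite mulr_suml.
apply: eq_bigr => i _; rewrite !lift0 -mulrA; congr (_ * _).
rewrite -mulrA -exprD -mulnSr; congr (theta ^+ _ * _).
have -> : (e %/ 8)%N = ((e - 24) %/ 8 + 3)%N by rewrite -{1}(subnK e24) divnDr.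
by rewrite mulnSr subnDr.
Qed.

(** * Bases from determinants *)

Lemma in_M_equivariant (rho : 'M[C]_2 -> 'M[C]_2) (F : 'cV[pol]_2) : representation rho ->
  in_M rho F <-> equivariant (rho T) (rho D) F.
Proof.
move=> rr; split=> [FM|[FT FD]]; last exact: equivariant_ind.
by split; apply: FM; [exact: in_G_T|exact: in_G_D].
Qed.

Lemma cramer2 (F u1 u2 : 'cV[pol]_2) :
  \det (columns (duo u1 u2)) *: F =
  \det (columns (duo F u2)) *: u1 + \det (columns (duo u1 F)) *: u2.
Proof.
apply/matrixP => i j; rewrite !det_duo !mxE ord1.
have [->|->] : i = 0 \/ i = 1.
- by case: i => [[|[|//]] Hi]; [left|right]; apply: val_inj.
- move: (F 0 0) (F 1 0) (u1 0 0) (u1 1 0) (u2 0 0) (u2 1 0) => a b c d e f; ring.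
move: (F 0 0) (F 1 0) (u1 0 0) (u1 1 0) (u2 0 0) (u2 1 0) => a b c d e f; ring.
Qed.

Lemma sum2 (V : nmodType) (F : 'I_2 -> V) : \sum_i F i = F 0 + F 1.
Proof. by rewrite big_ord_recl big_ord1; congr (_ + F _); apply: val_inj. Qed.

Lemma det_comb (a0 a1 : pol) u1 u2 :
  \det (columns (duo (a0 *: u1 + a1 *: u2) u2)) = a0 * \det (columns (duo u1 u2)) /\
  \det (columns (duo u1 (a0 *: u1 + a1 *: u2))) = a1 * \det (columns (duo u1 u2)).
Proof. by rewrite !det_duo !mxE; split; ring. Qed.

Lemma homog_det (F G : 'cV[pol]_2) d e : (forall i, F i 0 \is d.-homog) ->
  (forall i, G i 0 \is e.-homog) -> \det (columns (duo F G)) \is (d + e).-homog.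
Proof.
move=> Fh Gh; rewrite det_duo rpredB //; first exact: dhomogM.
rewrite addnC; exact: dhomogM.
Qed.

(** The contribution to degree [d] of a generator of degree [d1]. *)
Definition mod_dim d d1 : nat := if (d1 <= d)%N then inv_dim (d - d1) else 0.

Section Basis.

Variables (rho : 'M[C]_2 -> 'M[C]_2) (a b : nat) (u1 u2 : 'cV[pol]_2) (c : C).
Hypothesis rho_rep : representation rho.
Hypothesis detT : \det (rho T) = -1.
Hypothesis rhoD : rho D = diag2 a b.
Hypotheses (a4 : (a < 4)%N) (b4 : (b < 4)%N) (c0 : c != 0).
Hypotheses (u1M : in_M rho u1) (u2M : in_M rho u2).

Let W := Delta * Gamma ^+ (a + b).
Hypothesis detu : \det (columns (duo u1 u2)) = c%:MP * W.

Let cW0 : c%:MP * W != 0.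
Proof.
by rewrite !mulf_neq0 ?mpolyC_eq0 ?Delta_neq0 // expf_neq0 // Gamma_neq0.
Qed.

Lemma in_M_det F G : in_M rho F -> in_M rho G ->
  exists2 q, invariant q & \det (columns (duo F G)) = q * W.
Proof.
move=> /(in_M_equivariant _ rho_rep) FM /(in_M_equivariant _ rho_rep) GM.
rewrite rhoD in FM GM; exact: det_equivariant detT a4 b4 FM GM.
Qed.

Lemma in_M_span F : in_M rho F -> exists a0 a1 : pol,
  [/\ invariant a0, invariant a1 & F = a0 *: u1 + a1 *: u2].
Proof.
move=> FM; have [q1 q1i q1E] := in_M_det FM u2M; have [q2 q2i q2E] := in_M_det u1M FM.
exists (c^-1%:MP * q1), (c^-1%:MP * q2); split;
  try by apply: invariantM => //; apply: invariantC.
have h : (c%:MP * W) *: F = (c%:MP * W) *: ((c^-1%:MP * q1) *: u1 + (c^-1%:MP * q2) *: u2).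
  rewrite -{1}detu cramer2 q1E q2E scalerDr !scalerA.
  have e q : c%:MP * W * (c^-1%:MP * q) = q * W.
    by rewrite mulrACA -mpolyCM mulfV // mpolyC1 mul1r mulrC.
  by rewrite !e.
apply/matrixP => i j; have /matrixP/(_ i j) := h; rewrite [LHS]mxE [RHS]mxE.
exact: mulfI.
Qed.

Lemma in_M_indep (a0 a1 : pol) : a0 *: u1 + a1 *: u2 = 0 -> a0 = 0 /\ a1 = 0.
Proof.
have cancel (q : pol) : q * (c%:MP * W) = 0 -> q = 0.
  by move/eqP; rewrite mulf_eq0 (negbTE cW0) orbF => /eqP.
move=> h; have [e0 e1] := det_comb a0 a1 u1 u2; rewrite h detu in e0 e1.
by split; apply: cancel; [rewrite -e0|rewrite -e1];
  rewrite det_duo !mxE !(mul0r, mulr0) subrr.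
Qed.

Lemma free_basis_duo : free_basis rho (duo u1 u2).
Proof.
split=> [i|F FM|al _ h].
- by rewrite /duo; case: ifP.
- have [a0 [a1 [h0 h1 ->]]] := in_M_span FM.
  by exists (fun i => if i == 0 then a0 else a1); split=> [i|]; [case: ifP|rewrite sum2].
rewrite sum2 in h; have [e0 e1] := in_M_indep h.
case=> [[|[|//]] Hi]; [rewrite -[RHS]e0|rewrite -[RHS]e1]; congr al; exact: val_inj.
Qed.

Variables (d1 d2 : nat).
Hypotheses (u1h : forall i, u1 i 0 \is d1.-homog) (u2h : forall i, u2 i 0 \is d2.-homog).

(** The coordinates of a homogeneous element are homogeneous, being quotients of
    homogeneous determinants. *)
Lemma coord_homog d (a0 a1 : pol) :
  (forall i, (a0 *: u1 + a1 *: u2) i 0 \is d.-homog) ->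
  [/\ (d1 <= d)%N -> a0 \is (d - d1).-homog, (d < d1)%N -> a0 = 0,
      (d2 <= d)%N -> a1 \is (d - d2).-homog & (d < d2)%N -> a1 = 0].
Proof.
move=> Fh; have [e0 e1] := det_comb a0 a1 u1 u2.
have h12 := homog_det u1h u2h.
have h0 := homog_det Fh u2h; have h1 := homog_det u1h Fh.
rewrite e0 in h0; rewrite e1 in h1; rewrite detu in h0 h1 h12.
have [p0 z0] := dhomog_quot cW0 h12 h0; have [p1 z1] := dhomog_quot cW0 h12 h1.
rewrite leq_add2r subnDr ltn_add2r in p0 z0.
by rewrite [(d1 + d)%N]addnC [(d1 + d2)%N]addnC leq_add2r subnDr ltn_add2r in p1 z1.
Qed.

Lemma coord_span d d' (f : pol) : invariant f -> ((d' <= d)%N -> f \is (d - d').-homog) ->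
  ((d < d')%N -> f = 0) ->
  exists k : nat -> C, f = \sum_(i < mod_dim d d') (k i)%:MP * inv_basis (d - d') i.
Proof.
rewrite /mod_dim => fi h1 h2; case: leqP => dd; first exact: inv_span fi (h1 dd).
by exists (fun=> 0); rewrite big_ord0 h2.
Qed.

Lemma mod_basisP d d' i : (i < mod_dim d d')%N ->
  invariant (inv_basis (d - d') i) /\ inv_basis (d - d') i \is (d - d').-homog /\ (d' <= d)%N.
Proof. by rewrite /mod_dim; case: ifP => // dd h; have [] := inv_basisP h. Qed.

Lemma has_dim_M d : has_dim (in_Md rho d) (mod_dim d d1 + mod_dim d d2).
Proof.
exists (fun i => match split i with
         | inl j => inv_basis (d - d1) j *: u1
         | inr j => inv_basis (d - d2) j *: u2 end).
have MZ (f : pol) u : invariant f -> in_M rho u -> in_M rho (f *: u).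
  by move=> fi uM g Gg; rewrite map_mxZ /= fi // uM // scalemxAr.
split.
- move=> i; case: (split i) => j.
    have [ji [jh dd]] := mod_basisP (ltn_ord j); split=> [|k]; first exact: MZ.
    by rewrite mxE -[X in X.-homog](subnK dd) dhomogM.
  have [ji [jh dd]] := mod_basisP (ltn_ord j); split=> [|k]; first exact: MZ.
  by rewrite mxE -[X in X.-homog](subnK dd) dhomogM.
- move=> F [FM Fh]; have [a0 [a1 [i0 i1 FE]]] := in_M_span FM; rewrite FE in Fh *.
  have [p0 z0 p1 z1] := coord_homog Fh.
  have [k0 ->] := coord_span i0 p0 z0; have [k1 ->] := coord_span i1 p1 z1.
  exists (fun i => match split i with inl j => k0 j | inr j => k1 j end).
  rewrite big_split_ord /= !scaler_suml; congr (_ + _); apply: eq_bigr => j _.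
    by rewrite (unsplitK (inl _ j)) scalerA.
  by rewrite (unsplitK (inr _ j)) scalerA.
move=> k; rewrite big_split_ord /=.
have -> : \sum_(i < mod_dim d d1) (k (lshift _ i))%:MP *:
    match split (lshift (mod_dim d d2) i) with
    | inl j => inv_basis (d - d1) j *: u1 | inr j => inv_basis (d - d2) j *: u2 end
  = (\sum_(i < mod_dim d d1) (k (lshift _ i))%:MP * inv_basis (d - d1) i) *: u1.
  by rewrite scaler_suml; apply: eq_bigr => j _; rewrite (unsplitK (inl _ j)) scalerA.
have -> : \sum_(i < mod_dim d d2) (k (rshift _ i))%:MP *:
    match split (rshift (mod_dim d d1) i) with
    | inl j => inv_basis (d - d1) j *: u1 | inr j => inv_basis (d - d2) j *: u2 end
  = (\sum_(i < mod_dim d d2) (k (rshift _ i))%:MP * inv_basis (d - d2) i) *: u2.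
  by rewrite scaler_suml; apply: eq_bigr => j _; rewrite (unsplitK (inr _ j)) scalerA.
have free n e (l : 'I_n -> C) : \sum_(i < n) (l i)%:MP * inv_basis e i = 0 -> forall i, l i = 0.
  move=> h i; pose l' m := if insub m is Some j then l j else 0.
  have l'E j : l' (nat_of_ord j) = l j by rewrite /l' valK.
  rewrite -l'E; apply: (@theta_Gamma_free n l' (fun i => (e %/ 8 - 3 * i)%N)) => //.
  by rewrite -[RHS]h; apply: eq_bigr => j _; rewrite l'E.
move=> /in_M_indep[/free h0 /free h1] i.
by rewrite -(splitK i); case: (split i) => j /=; [exact: h0|exact: h1].
Qed.

End Basis.

(** * The generators *)

Definition col2 (p q : pol) : 'cV[pol]_2 := \col_i (if i == 0 then p else q).

Lemma eq_col2 (p q p' q' : pol) : p = p' -> q = q' -> col2 p q = col2 p' q'.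
Proof. by move=> -> ->. Qed.

Lemma map_act_col2 g p q : map_mx (act g) (col2 p q) = col2 (act g p) (act g q).
Proof. by apply/matrixP => i j; rewrite !mxE; case: ifP. Qed.

Lemma equivariantZ (e h : C) (f : pol) (A B : 'M[C]_2) F :
  act T f = e%:MP * f -> act D f = h%:MP * f -> equivariant A B F ->
  equivariant (e *: A) (h *: B) (f *: F).
Proof.
have scale g (c : C) (M : 'M[C]_2) : act g f = c%:MP * f ->
    map_mx (act g) F = cst M *m F -> map_mx (act g) (f *: F) = cst (c *: M) *m (f *: F).
  by move=> gf gF; rewrite !map_mxZ /= gf gF -scalemxAl -scalemxAr scalerA.
by move=> Tf Df [TF DF]; split; apply: scale.
Qed.

Definition euler := col2 x y.

(** For a relative invariant [f] with [f (g x) = chi g * f], the chain rule makes the rotated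
    gradient [(f_y, - f_x)] equivariant for [g] times [chi g / det g].  The following three
    vectors are the rotated gradients of [Gamma], [theta] and [Delta] divided by [1], [8]
    and [12]. *)
Definition rgrad_Gamma (X Y : pol) :=
  col2 ((X * Y ^+ 4) *+ 5 - X ^+ 5) ((X ^+ 4 * Y) *+ 5 - Y ^+ 5).
Definition rgrad_theta (X Y : pol) :=
  col2 ((X ^+ 4 * Y ^+ 3) *+ 7 + Y ^+ 7) (- X ^+ 7 - (X ^+ 3 * Y ^+ 4) *+ 7).
Definition rgrad_Delta (X Y : pol) :=
  col2 (Y ^+ 11 - (X ^+ 8 * Y ^+ 3) *+ 11 - (X ^+ 4 * Y ^+ 7) *+ 22)
       ((X ^+ 7 * Y ^+ 4) *+ 22 + (X ^+ 3 * Y ^+ 8) *+ 11 - X ^+ 11).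

(** With [p = X^4 + Y^4] and [q = X^2 Y^2], the matrix [T] sends [p] to [p/2 + 3q] and [q] to
    [p/4 - q/2].  Hence [(p, 2q)] and [(12pq, p^2 - 12q^2)] transform by [S] under [T]. *)
Definition quartic (X Y : pol) := col2 (X ^+ 4 + Y ^+ 4) ((X ^+ 2 * Y ^+ 2) *+ 2).
Definition octic (X Y : pol) :=
  col2 ((X ^+ 6 * Y ^+ 2 + X ^+ 2 * Y ^+ 6) *+ 12) (X ^+ 8 - (X ^+ 4 * Y ^+ 4) *+ 10 + Y ^+ 8).

Lemma map_act_rgrad_Gamma g : map_mx (act g) (rgrad_Gamma x y) = rgrad_Gamma (act g x) (act g y).
Proof. by rewrite map_act_col2; apply: eq_col2; ring. Qed.
Lemma map_act_rgrad_theta g : map_mx (act g) (rgrad_theta x y) = rgrad_theta (act g x) (act g y).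
Proof. by rewrite map_act_col2; apply: eq_col2; ring. Qed.
Lemma map_act_rgrad_Delta g : map_mx (act g) (rgrad_Delta x y) = rgrad_Delta (act g x) (act g y).
Proof. by rewrite map_act_col2; apply: eq_col2; ring. Qed.
Lemma map_act_quartic g : map_mx (act g) (quartic x y) = quartic (act g x) (act g y).
Proof. by rewrite map_act_col2; apply: eq_col2; ring. Qed.
Lemma map_act_octic g : map_mx (act g) (octic x y) = octic (act g x) (act g y).
Proof. by rewrite map_act_col2; apply: eq_col2; ring. Qed.

Lemma cst_mul_col2 (A : 'M[C]_2) p q :
  cst A *m col2 p q = col2 ((A 0 0)%:MP * p + (A 0 1)%:MP * q) ((A 1 0)%:MP * p + (A 1 1)%:MP * q).
Proof.
apply/matrixP => i j; rewrite mulmx2E !mxE /=.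
by case: i => [[|[|//]] Hi]; rewrite -!val_eqE /=;
  congr ((A _ _)%:MP * _ + (A _ _)%:MP * _); apply: val_inj.
Qed.

Lemma equivariant_euler : equivariant T D euler.
Proof. by split; rewrite map_act_col2 cst_mul_col2 -actx -acty. Qed.

Lemma half_r : 2^-1%:MP = r ^+ 2.
Proof. by rewrite -rmorphXn /= exprVn sqrtCK. Qed.

Lemma equivariant_rgrad_Gamma : equivariant (- T) D (rgrad_Gamma x y).
Proof.
split; rewrite map_act_rgrad_Gamma ?actTx ?actTy ?actDx ?actDy cst_mul_col2 ?matTE !mxE /=;
  apply: eq_col2; rewrite ?(mpolyCN, mpolyC1, mpolyC0); move: x y => X Y.
- move: r r_sq => q hq; rewrite -[RHS]mul1r -[1 in RHS](expr1n _ 2) -hq; ring.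
- move: r r_sq => q hq; rewrite -[RHS]mul1r -[1 in RHS](expr1n _ 2) -hq; ring.
- by move: 'i%:MP i_sqC => z hz; ring: hz.
- by move: 'i%:MP i_sqC => z hz; ring: hz.
Qed.

Lemma equivariant_rgrad_theta : equivariant (- T) (- 'i *: D) (rgrad_theta x y).
Proof.
split; rewrite map_act_rgrad_theta ?actTx ?actTy ?actDx ?actDy cst_mul_col2 ?matTE !mxE /=;
  apply: eq_col2; rewrite ?(mpolyCM, mpolyCN, mpolyC1, mpolyC0); move: x y => X Y.
- move: r r_sq => q hq; rewrite -[RHS]mul1r -[1 in RHS](expr1n _ 3) -hq; ring.
- move: r r_sq => q hq; rewrite -[RHS]mul1r -[1 in RHS](expr1n _ 3) -hq; ring.
- by move: 'i%:MP i_sqC => z hz; ring: hz.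
- by move: 'i%:MP i_sqC => z hz; ring: hz.
Qed.

Lemma equivariant_rgrad_Delta : equivariant T (- 'i *: D) (rgrad_Delta x y).
Proof.
split; rewrite map_act_rgrad_Delta ?actTx ?actTy ?actDx ?actDy cst_mul_col2 ?matTE !mxE /=;
  apply: eq_col2; rewrite ?(mpolyCM, mpolyCN, mpolyC1, mpolyC0); move: x y => X Y.
- move: r r_sq => q hq; rewrite -[RHS]mul1r -[1 in RHS](expr1n _ 5) -hq; ring.
- move: r r_sq => q hq; rewrite -[RHS]mul1r -[1 in RHS](expr1n _ 5) -hq; ring.
- by move: 'i%:MP i_sqC => z hz; ring: hz.
- by move: 'i%:MP i_sqC => z hz; ring: hz.
Qed.

Lemma equivariant_quartic : equivariant (matS C) (mx22 1 0 0 (-1)) (quartic x y).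
Proof.
split; rewrite map_act_quartic ?actTx ?actTy ?actDx ?actDy cst_mul_col2 !mxE /=;
  apply: eq_col2; rewrite ?(mpolyCM, mpolyCN, mpolyC1, mpolyC0) ?half_r ?mulrN1 ?mulr1 /=; move: x y => X Y.
- move: r r_sq => q hq; rewrite -[RHS]mul1r -[1 in RHS](expr1n _ 1) -hq; ring.
- move: r r_sq => q hq; rewrite -[RHS]mul1r -[1 in RHS](expr1n _ 1) -hq; ring.
- by move: 'i%:MP i_sqC => z hz; ring: hz.
- by move: 'i%:MP i_sqC => z hz; ring: hz.
Qed.

Lemma equivariant_octic : equivariant (matS C) (mx22 (-1) 0 0 1) (octic x y).
Proof.
split; rewrite map_act_octic ?actTx ?actTy ?actDx ?actDy cst_mul_col2 !mxE /=;
  apply: eq_col2; rewrite ?(mpolyCM, mpolyCN, mpolyC1, mpolyC0) ?half_r ?mulrN1 ?mulr1 /=; move: x y => X Y.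
- move: r r_sq => q hq; rewrite -[RHS]mul1r -[1 in RHS](expr1n _ 3) -hq; ring.
- move: r r_sq => q hq; rewrite -[RHS]mul1r -[1 in RHS](expr1n _ 3) -hq; ring.
- by move: 'i%:MP i_sqC => z hz; ring: hz.
- by move: 'i%:MP i_sqC => z hz; ring: hz.
Qed.

Lemma equivariant_Gamma m A B (F : 'cV[pol]_2) :
  equivariant A B F -> equivariant A ('i ^+ m *: B) (Gamma ^+ m *: F).
Proof.
move=> AB; rewrite -[A]scale1r; apply: equivariantZ AB.
  by rewrite mpolyC1 mul1r rmorphXn /= act_T_Gamma.
by rewrite rmorphXn /= act_D_Gamma exprMn rmorphXn.
Qed.

Lemma equivariant_Delta A B (F : 'cV[pol]_2) :
  equivariant A B F -> equivariant (- A) B (Delta *: F).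
Proof.
move=> AB; rewrite -[B]scale1r -scaleN1r; apply: equivariantZ AB.
  by rewrite mpolyCN mpolyC1 mulN1r act_T_Delta.
by rewrite mpolyC1 mul1r act_D_Delta.
Qed.

Lemma equivariant_const c A B (F : 'cV[pol]_2) :
  equivariant A B F -> equivariant A B (c%:MP *: F).
Proof.
by move=> AB; rewrite -[A]scale1r -[B]scale1r; apply: equivariantZ AB;
  rewrite actC mpolyC1 mul1r.
Qed.

Definition homog_col d (F : 'cV[pol]_2) : Prop := forall i, F i 0 \is d.-homog.

Lemma homog_colZ d e (f : pol) F : f \is d.-homog -> homog_col e F -> homog_col (d + e) (f *: F).
Proof. by move=> fh Fh i; rewrite mxE; apply: dhomogM. Qed.

Lemma homog_col2 d p q : p \is d.-homog -> q \is d.-homog -> homog_col d (col2 p q).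
Proof. by move=> ph qh i; rewrite mxE; case: ifP. Qed.

Lemma homog_Gamma_pow m : Gamma ^+ m \is (6 * m).-homog.
Proof. exact: (dhomogMn m homog_Gamma). Qed.

Lemma homog_euler : homog_col 1 euler.
Proof. exact: homog_col2 homog_x homog_y. Qed.

Lemma homog_rgrad_Gamma : homog_col 5 (rgrad_Gamma x y).
Proof.
apply: homog_col2; apply: rpredB.
- apply: rpredMn; exact: (homog_xy 1 4).
- exact: (dhomogMn 5 homog_x).
- apply: rpredMn; exact: (homog_xy 4 1).
- exact: (dhomogMn 5 homog_y).
Qed.

Lemma homog_rgrad_theta : homog_col 7 (rgrad_theta x y).
Proof.
apply: homog_col2; [apply: rpredD|apply: rpredB; first (rewrite rpredN)].
- apply: rpredMn; exact: (homog_xy 4 3).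
- exact: (dhomogMn 7 homog_y).
- exact: (dhomogMn 7 homog_x).
- apply: rpredMn; exact: (homog_xy 3 4).
Qed.

Lemma homog_rgrad_Delta : homog_col 11 (rgrad_Delta x y).
Proof.
apply: homog_col2.
  apply: rpredB; last by apply: rpredMn; exact: (homog_xy 4 7).
  apply: rpredB; first exact: (dhomogMn 11 homog_y).
  by apply: rpredMn; exact: (homog_xy 8 3).
apply: rpredB; last exact: (dhomogMn 11 homog_x).
by apply: rpredD; apply: rpredMn; [exact: (homog_xy 7 4)|exact: (homog_xy 3 8)].
Qed.

Lemma homog_quartic : homog_col 4 (quartic x y).
Proof.
apply: homog_col2; [apply: rpredD|apply: rpredMn].
- exact: (dhomogMn 4 homog_x).
- exact: (dhomogMn 4 homog_y).
- exact: (homog_xy 2 2).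
Qed.

Lemma homog_octic : homog_col 8 (octic x y).
Proof.
apply: homog_col2.
  by apply: rpredMn; apply: rpredD; [exact: (homog_xy 6 2)|exact: (homog_xy 2 6)].
apply: rpredD; last exact: (dhomogMn 8 homog_y).
apply: rpredB; first exact: (dhomogMn 8 homog_x).
by apply: rpredMn; exact: (homog_xy 4 4).
Qed.

Lemma det_col2 p q p' q' : \det (columns (duo (col2 p q) (col2 p' q'))) = p * q' - p' * q :> pol.
Proof. by rewrite det_duo !mxE. Qed.

Lemma det_duoZ (f g : pol) F H :
  \det (columns (duo (f *: F) (g *: H))) = f * g * \det (columns (duo F H)).
Proof.
rewrite !det_duo !mxE; move: (F 0 0) (F 1 0) (H 0 0) (H 1 0) => p q p' q'; ring.
Qed.

Lemma det_swap (F H : 'cV[pol]_2) : \det (columns (duo F H)) = - \det (columns (duo H F)).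
Proof. by rewrite !det_duo opprB. Qed.

Lemma det_euler_rgrad_Gamma : \det (columns (duo euler (rgrad_Gamma x y))) = - (Gamma *+ 6).
Proof. by rewrite det_col2 /Gamma; move: x y => X Y; ring. Qed.

Lemma det_rgrad_Delta_euler : \det (columns (duo (rgrad_Delta x y) euler)) = Delta.
Proof. by rewrite det_col2 /Delta; move: x y => X Y; ring. Qed.

Lemma det_rgrad_theta_rgrad_Gamma :
  \det (columns (duo (rgrad_theta x y) (rgrad_Gamma x y))) = - Delta.
Proof. by rewrite det_col2 /Delta; move: x y => X Y; ring. Qed.

Lemma det_octic_quartic : \det (columns (duo (octic x y) (quartic x y))) = - Delta.
Proof. by rewrite det_col2 /Delta; move: x y => X Y; ring. Qed.

Lemma det_duo_neq0 (F H : 'cV[pol]_2) : \det (columns (duo F H)) != 0 -> F != 0 /\ H != 0.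
Proof.
rewrite det_duo => h; split; apply: contra_neq h => ->; rewrite !mxE !(mul0r, mulr0) subrr //.
Qed.

(** Any two homogeneous equivariants with a nonzero multiple of
    [Delta * Gamma ^+ (a + b)] as determinant yield the representation and a basis
    of its module; rescaling one of them adjusts the constant. *)
Lemma basis_of_determinant (A B : 'M[C]_2) a b u1 u2 c0 c d1 d2 :
  equivariant A B u1 -> equivariant A B u2 -> homog_col d1 u1 -> homog_col d2 u2 ->
  \det A = -1 -> B = diag2 a b -> (a < 4)%N -> (b < 4)%N -> c0 != 0 -> c != 0 ->
  \det (columns (duo u1 u2)) = c0%:MP * (Delta * Gamma ^+ (a + b)) ->
  (exists rho : 'M[C]_2 -> 'M[C]_2, [/\ representation rho, rho T = A & rho D = B]) /\
  forall rho : 'M[C]_2 -> 'M[C]_2, [/\ representation rho, rho T = A & rho D = B] ->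
  (exists u : 'I_2 -> 'cV[pol]_2,
      [/\ free_basis rho u,
          u 0 != 0 /\ in_Md rho d1 (u 0),
          u 1 != 0 /\ in_Md rho d2 (u 1)
        & \det (\matrix_(a < 2, b < 2) u b a 0) = c%:MP * Delta * Gamma ^+ (a + b)]) /\
  forall d, has_dim (in_Md rho d) (mod_dim d d1 + mod_dim d d2).
Proof.
move=> e1 e2 h1 h2 dA BE a4 b4 c00 cn0 du.
have W0 (k : C) : k != 0 -> k%:MP * (Delta * Gamma ^+ (a + b)) != 0.
  by move=> k0; rewrite !mulf_neq0 ?mpolyC_eq0 ?Delta_neq0 // expf_neq0 // Gamma_neq0.
split.
  have cols g M : map_mx (act g) u1 = cst M *m u1 -> map_mx (act g) u2 = cst M *m u2 ->
      map_mx (act g) (columns (duo u1 u2)) = cst M *m columns (duo u1 u2).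
    by move=> ? ?; apply: columns_equiv => k; rewrite /duo; case: ifP.
  case: e1 e2 => T1 D1 [T2 D2].
  apply: (@exists_rep (columns (duo u1 u2))); rewrite ?du ?W0 //; try exact: cols.
    by rewrite unitmxE dA unitrN1.
  rewrite unitmxE BE det2 !mxE /= mul0r subr0 unitfE -exprD expf_neq0 //.
  exact: i_neq0.
move=> rho [rr rT rD]; pose u2' := (c / c0)%:MP *: u2.
have e2' : equivariant A B u2' by apply: equivariant_const.
have h2' : homog_col d2 u2' by move=> i; rewrite mxE mul_mpolyC dhomogZ ?h2.
have du' : \det (columns (duo u1 u2')) = c%:MP * (Delta * Gamma ^+ (a + b)).
  by rewrite -[u1]scale1r det_duoZ mul1r du mulrA -mpolyCM divfK.
have M1 : in_M rho u1 by apply/in_M_equivariant; rewrite // rT rD.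
have M2 : in_M rho u2' by apply/in_M_equivariant; rewrite // rT rD.
have [n1 n2] : u1 != 0 /\ u2' != 0 by apply: det_duo_neq0; rewrite du' W0.
have dT : \det (rho T) = -1 by rewrite rT.
have rDE : rho D = diag2 a b by rewrite rD.
split; last by move=> d; apply: (has_dim_M rr dT rDE a4 b4 cn0 M1 M2 du' h1 h2').
exists (duo u1 u2'); split=> //; last by rewrite -mulrA.
exact: (free_basis_duo rr dT rDE a4 b4 cn0 M1 M2 du').
Qed.

(** * The rows of the table *)

Definition row_holds (t : entry C) : Prop :=
  (exists rho : 'M[C]_2 -> 'M[C]_2, [/\ representation rho, rho T = tab_T t & rho D = tab_D t]) /\
  forall rho : 'M[C]_2 -> 'M[C]_2, [/\ representation rho, rho T = tab_T t & rho D = tab_D t] ->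
  (exists u : 'I_2 -> 'cV[pol]_2,
      [/\ free_basis rho u,
          u 0 != 0 /\ in_Md rho (tab_d1 t) (u 0),
          u 1 != 0 /\ in_Md rho (tab_d2 t) (u 1)
        & \det (\matrix_(a < 2, b < 2) u b a 0)
            = (tab_c t)%:~R%:MP * Delta * Gamma ^+ tab_k t]) /\
    (forall d : nat, (d < size (tab_H t))%N ->
      has_dim (in_Md rho d) ((tab_H t)`_d)%R) /\
    (tab_d1 t + tab_d2 t
       = (msize Delta).-1 + tab_k t * (msize Gamma).-1)%N /\
    (tab_d1 t + tab_d2 t = 12 + 6 * tab_k t)%N.

Lemma dhomog_degree d (f : pol) : f != 0 -> f \is d.-homog -> (msize f).-1 = d.
Proof. by move=> f0 fh; apply: (dhomog_uniq f0 _ fh); apply: dhomog_msize fh. Qed.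

Definition covariant (A B : 'M[C]_2) d (F : 'cV[pol]_2) : Prop :=
  equivariant A B F /\ homog_col d F.

Lemma covariant_Gamma m A B d (F : 'cV[pol]_2) : covariant A B d F ->
  covariant A ('i ^+ m *: B) (6 * m + d) (Gamma ^+ m *: F).
Proof.
case=> AB Fh; split; first exact: equivariant_Gamma.
exact: homog_colZ (homog_Gamma_pow m) Fh.
Qed.

Lemma covariant_Delta A B d (F : 'cV[pol]_2) : covariant A B d F ->
  covariant (- A) B (12 + d) (Delta *: F).
Proof.
case=> AB Fh; split; first exact: equivariant_Delta.
exact: homog_colZ homog_Delta Fh.
Qed.

Local Notation gG := (rgrad_Gamma x y).
Local Notation gD := (rgrad_Delta x y).
Local Notation gth := (rgrad_theta x y).
Local Notation v4 := (quartic x y).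
Local Notation v8 := (octic x y).

Lemma covariant_euler : covariant T D 1 euler.
Proof. by split; [exact: equivariant_euler|exact: homog_euler]. Qed.

Lemma covariant_rgrad_Gamma : covariant (- T) D 5 gG.
Proof. by split; [exact: equivariant_rgrad_Gamma|exact: homog_rgrad_Gamma]. Qed.

Lemma covariant_rgrad_theta : covariant (- T) (- 'i *: D) 7 gth.
Proof. by split; [exact: equivariant_rgrad_theta|exact: homog_rgrad_theta]. Qed.

Lemma covariant_rgrad_Delta : covariant T (- 'i *: D) 11 gD.
Proof. by split; [exact: equivariant_rgrad_Delta|exact: homog_rgrad_Delta]. Qed.

Lemma covariant_quartic : covariant (matS C) (mx22 1 0 0 (-1)) 4 v4.
Proof. by split; [exact: equivariant_quartic|exact: homog_quartic]. Qed.

Lemma covariant_octic : covariant (matS C) (mx22 (-1) 0 0 1) 8 v8.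
Proof. by split; [exact: equivariant_octic|exact: homog_octic]. Qed.

Lemma hilbert_coef (H : {poly nat}) (h : nat -> nat) (N : nat) (g : nat -> nat) :
  (forall d, H`_d = g d) -> (forall d, g (N + d)%N = 0%N) ->
  all (fun d => g d == h d) (iota 0 N) ->
  forall d, (d < size H)%N -> H`_d = h d.
Proof.
move=> HE g0 /allP gh d dH; rewrite HE; apply/eqP/gh; rewrite mem_iota /= add0n.
by apply: (leq_trans dH); apply/leq_sizeP => k /subnKC <-; rewrite HE.
Qed.

Lemma det_T : \det T = -1.
Proof. by rewrite det2 matTE !mxE /=; have ns := s_neq0; field: s_sq. Qed.

Lemma det_matS : \det (matS C) = -1.
Proof. by rewrite det2 !mxE /=; field. Qed.

Lemma det_NT : \det (- T) = -1.
Proof. by rewrite -scaleN1r detZ det_T sqrrN expr1n mul1r. Qed.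

(** The last degree shown in a row is [d1 + 32], so its truncated Hilbert series has no
    coefficient from [d1 + 33] on; below that, comparing it with the dimensions is a
    computation. *)
Lemma row_of_covariants (t : entry C) a b c0 A1 B1 e1 u1 A2 B2 e2 u2 (h : nat -> nat) :
  covariant A1 B1 e1 u1 -> covariant A2 B2 e2 u2 ->
  \det (columns (duo u1 u2)) = c0%:MP * (Delta * Gamma ^+ (a + b)) -> c0 != 0 ->
  [/\ A1 = tab_T t, A2 = tab_T t & \det (tab_T t) = -1] ->
  [/\ B1 = tab_D t, B2 = tab_D t & tab_D t = diag2 a b] ->
  [&& e1 == tab_d1 t, e2 == tab_d2 t, tab_k t == (a + b)%N, a < 4, b < 4,
      tab_c t != 0 & tab_d1 t + tab_d2 t == 12 + 6 * tab_k t]%N ->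
  (forall d, (tab_H t)`_d = h d) -> (forall d, h (tab_d1 t + 33 + d)%N = 0%N) ->
  all (fun d => h d == mod_dim d (tab_d1 t) + mod_dim d (tab_d2 t))%N (iota 0 (tab_d1 t + 33)) ->
  row_holds t.
Proof.
move=> [E1 h1] [E2 h2] du c00 [TE1 TE2 dT] [DE1 DE2 DE].
case/and5P => /eqP ee1 /eqP ee2 /eqP kE a4 /and3P[b4 c1 /eqP degs] HE H0 hilb.
rewrite TE1 DE1 in E1; rewrite TE2 DE2 in E2; rewrite ee1 in h1; rewrite ee2 in h2.
have c2 : (tab_c t)%:~R != 0 :> C by rewrite intr_eq0.
have [ex all] := basis_of_determinant E1 E2 h1 h2 dT DE a4 b4 c00 c2 du.
split=> // rho /all [exu dims]; rewrite kE; split=> //; split.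
  by move=> d /(hilbert_coef HE H0 hilb) ->; apply: dims.
rewrite (dhomog_degree Delta_neq0 homog_Delta).
by rewrite (dhomog_degree Gamma_neq0 homog_Gamma) -kE degs mulnC.
Qed.

Ltac matrix_eq := let i := fresh in let j := fresh in
  apply/matrixP => i j; rewrite ?matTE !mxE;
  case: i j => [[|[|//]] ?] [[|[|//]] ?] /=; ring: i_sq.

Ltac finish_row :=
  [> by rewrite ?oppr_eq0 ?oner_eq0 ?pnatr_eq0
  | by split; try (exact: det_T || exact: det_NT || exact: det_matS || matrix_eq)
  | by split; rewrite /diag2 /=; matrix_eq
  | by []
  | by move=> ?; rewrite !(coefD, coefMn, coefXn, coefX)
  | by []
  | by vm_compute ].

Lemma row9 : row_holds (table C 9).
Proof.
apply: (@row_of_covariants _ 0 1 (- 6) _ _ _ _ _ _ _ _ _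
  covariant_euler (covariant_Delta covariant_rgrad_Gamma)).
  by rewrite -[euler]scale1r det_duoZ det_euler_rgrad_Gamma mpolyCN (rmorph_nat (@mpolyC 2 C)); ring.
all: finish_row.
Qed.

Lemma row10 : row_holds (table C 10).
Proof.
apply: (@row_of_covariants _ 1 2 (- 6) _ _ _ _ _ _ _ _ _
  (covariant_Gamma 1 covariant_euler) (covariant_Gamma 1 (covariant_Delta covariant_rgrad_Gamma))).
  by rewrite det_duoZ -[euler]scale1r det_duoZ det_euler_rgrad_Gamma mpolyCN (rmorph_nat (@mpolyC 2 C)); ring.
all: finish_row.
Qed.

Lemma row11 : row_holds (table C 11).
Proof.
apply: (@row_of_covariants _ 2 3 (- 6) _ _ _ _ _ _ _ _ _
  (covariant_Gamma 2 covariant_euler) (covariant_Gamma 2 (covariant_Delta covariant_rgrad_Gamma))).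
  by rewrite det_duoZ -[euler]scale1r det_duoZ det_euler_rgrad_Gamma mpolyCN (rmorph_nat (@mpolyC 2 C)); ring.
all: finish_row.
Qed.

Lemma row12 : row_holds (table C 12).
Proof.
apply: (@row_of_covariants _ 3 0 (1) _ _ _ _ _ _ _ _ _
  covariant_rgrad_Delta (covariant_Gamma 3 covariant_euler)).
  by rewrite -[gD]scale1r det_duoZ det_rgrad_Delta_euler mpolyC1; ring.
all: finish_row.
Qed.

Lemma row13 : row_holds (table C 13).
Proof.
apply: (@row_of_covariants _ 0 1 (6) _ _ _ _ _ _ _ _ _
  covariant_rgrad_Gamma (covariant_Delta covariant_euler)).
  by rewrite -[gG]scale1r det_duoZ det_swap det_euler_rgrad_Gamma (rmorph_nat (@mpolyC 2 C)); ring.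
all: finish_row.
Qed.

Lemma row14 : row_holds (table C 14).
Proof.
apply: (@row_of_covariants _ 1 2 (6) _ _ _ _ _ _ _ _ _
  (covariant_Gamma 1 covariant_rgrad_Gamma) (covariant_Gamma 1 (covariant_Delta covariant_euler))).
  by rewrite det_duoZ -[gG]scale1r det_duoZ det_swap det_euler_rgrad_Gamma (rmorph_nat (@mpolyC 2 C)); ring.
all: finish_row.
Qed.

Lemma row15 : row_holds (table C 15).
Proof.
apply: (@row_of_covariants _ 2 3 (6) _ _ _ _ _ _ _ _ _
  (covariant_Gamma 2 covariant_rgrad_Gamma) (covariant_Gamma 2 (covariant_Delta covariant_euler))).
  by rewrite det_duoZ -[gG]scale1r det_duoZ det_swap det_euler_rgrad_Gamma (rmorph_nat (@mpolyC 2 C)); ring.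
all: finish_row.
Qed.

Lemma row16 : row_holds (table C 16).
Proof.
apply: (@row_of_covariants _ 3 0 (- 1) _ _ _ _ _ _ _ _ _
  covariant_rgrad_theta (covariant_Gamma 3 covariant_rgrad_Gamma)).
  by rewrite -[gth]scale1r det_duoZ det_rgrad_theta_rgrad_Gamma mpolyCN mpolyC1; ring.
all: finish_row.
Qed.

Lemma row17 : row_holds (table C 17).
Proof.
apply: (@row_of_covariants _ 2 0 (- 1) _ _ _ _ _ _ _ _ _
  covariant_octic (covariant_Gamma 2 covariant_quartic)).
  by rewrite -[v8]scale1r det_duoZ det_octic_quartic mpolyCN mpolyC1; ring.
all: finish_row.
Qed.

Lemma row18 : row_holds (table C 18).
Proof.
apply: (@row_of_covariants _ 1 3 (1) _ _ _ _ _ _ _ _ _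
  (covariant_Gamma 1 covariant_quartic) (covariant_Gamma 3 covariant_octic)).
  by rewrite det_duoZ det_swap det_octic_quartic mpolyC1; ring.
all: finish_row.
Qed.

Lemma row19 : row_holds (table C 19).
Proof.
apply: (@row_of_covariants _ 0 2 (1) _ _ _ _ _ _ _ _ _
  covariant_quartic (covariant_Gamma 2 covariant_octic)).
  by rewrite -[v4]scale1r det_duoZ det_swap det_octic_quartic mpolyC1; ring.
all: finish_row.
Qed.

Lemma row20 : row_holds (table C 20).
Proof.
apply: (@row_of_covariants _ 3 1 (- 1) _ _ _ _ _ _ _ _ _
  (covariant_Gamma 1 covariant_octic) (covariant_Gamma 3 covariant_quartic)).
  by rewrite det_duoZ det_octic_quartic mpolyCN mpolyC1; ring.
all: finish_row.
Qed.

Lemma rows j : (9 <= j <= 20)%N -> row_holds (table C j).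
Proof.
move=> hj; have : j \in iota 9 12 by rewrite mem_iota.
rewrite !inE; repeat case/predU1P=> [->|]; last move/eqP->.
- exact: row9.
- exact: row10.
- exact: row11.
- exact: row12.
- exact: row13.
- exact: row14.
- exact: row15.
- exact: row16.
- exact: row17.
- exact: row18.
- exact: row19.
exact: row20.
Qed.

End Invariants.

Theorem theorem2 (R : realType) (j : nat) (hj : (9 <= j <= 20)%N) :
  (exists rho : 'M[R[i]]_2 -> 'M[R[i]]_2, is_rho j rho) /\
  forall rho : 'M[R[i]]_2 -> 'M[R[i]]_2, is_rho j rho ->
    let t := table R[i] j in
    (exists u : 'I_2 -> 'cV[{mpoly R[i][2]}]_2,
      [/\ free_basis rho u,
          u 0 != 0 /\ in_Md rho (tab_d1 t) (u 0),
          u 1 != 0 /\ in_Md rho (tab_d2 t) (u 1)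
        & \det (\matrix_(a < 2, b < 2) u b a 0)
            = (tab_c t)%:~R%:MP * Delta R[i] * Gamma R[i] ^+ tab_k t]) /\
    (forall d : nat, (d < size (tab_H t))%N ->
      has_dim (in_Md rho d) ((tab_H t)`_d)%R) /\
    (tab_d1 t + tab_d2 t
       = (msize (Delta R[i])).-1 + tab_k t * (msize (Gamma R[i])).-1)%N /\
    (tab_d1 t + tab_d2 t = 12 + 6 * tab_k t)%N.
Proof.
have [ex all] := rows R[i] hj.
by split=> [|rho /all]; [exact: ex|].
Qed.
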